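(* Let $\mathcal{H}$ be a complex Hilbert space, let $c\in\mathbb{C}$, let $K$ be a compact operator on $\mathcal{H}$, and let $T=cI+K$. Then the closure $\overline{W(T)}$ of the numerical range of $T$ is not equal to a closed half disk (of positive radius), nor is it equal to any closed acute circular sector (a circular sector of positive radius whose angle $\theta$ satisfies $0<\theta<\pi/2$).
   Context: The numerical range of an operator $T$ on $\mathcal{H}$ is $W(T)=\{\langle Tx,x\rangle : x\in\mathcal{H},\ \|x\|=1\}$. A half disk means half of a disk in $\mathbb{C}$ cut along a diameter; a circular sector is the region of a disk in $\mathbb{C}$ bounded by two radii and the arc between them. *)

(* Defs.v *)
From mathcomp Require Import all_boot all_order all_algebra.
From mathcomp Require Import complex.
From mathcomp Require Import all_classical all_reals all_analysis.

Set Implicit Arguments.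
Unset Strict Implicit.
Unset Printing Implicit Defensive.
Import Order.TTheory GRing.Theory Num.Theory.
Import numFieldNormedType.Exports.
Local Open Scope classical_set_scope.
Local Open Scope ring_scope.
Local Open Scope complex_scope.

(* The topology on the complex numbers is carried by the alias R[i]^o, that of
   the numeric field R[i] seen as a normed space over itself; subsets of the
   plane are therefore given the type set R[i]^o. *)

(* A complex Hilbert space is a complete normed space over R[i] whose norm
   comes from an inner product.  A term of {dot H for Num.conj} is a positive
   definite hermitian form, linear in its first argument and conjugate linear
   in the second. The norm takes its (real, nonnegative) values in R[i]. *)
Definition norm_from_dot (R : realType) (H : normedModType R[i])
    (dot : {dot H for (@Num.conj R[i])}) : Prop :=
  forall x : H, `|x| ^+ 2 = dot x x.

Definition compact_operator (R : realType) (H : normedModType R[i])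
    (K : {linear H -> H}) : Prop :=
  forall A : set H, bounded_set A -> precompact (K @` A).

Definition numerical_range (R : realType) (H : normedModType R[i])
    (dot : {dot H for (@Num.conj R[i])}) (T : H -> H) : set R[i]^o :=
  [set dot (T x) x | x in [set x : H | `|x| = 1]].

(* Half of the closed disk of center z0 and radius r, cut along the diameter
   perpendicular to the direction u (a unit complex number). *)
Definition closed_half_disk (R : realType) (z0 : R[i]) (r : R) (u : R[i]) :
    set R[i]^o :=
  [set z : R[i] | `|z - z0| <= r%:C /\ 0 <= complex.Re ((z - z0) * u^*)].

(* Closed circular sector of center z0, radius r and angle theta; its two
   radii point in the directions alpha and alpha + theta. *)
Definition closed_sector (R : realType) (z0 : R[i]) (r alpha theta : R) :
    set R[i]^o :=
  [set z : R[i] | exists rho t : R, [/\ 0 <= rho <= r,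
     alpha <= t <= alpha + theta & z = z0 + rho%:C * (cos t +i* sin t)]].

(* Main.v *)
Require Import Defs.
From mathcomp Require Import all_boot all_order all_algebra.
From mathcomp Require Import complex.
From mathcomp Require Import all_classical all_reals all_analysis.
From mathcomp Require Import ring lra.
Set Implicit Arguments.
Unset Strict Implicit.
Unset Printing Implicit Defensive.
Import Order.TTheory GRing.Theory Num.Theory.
Import numFieldNormedType.Exports.
Local Open Scope classical_set_scope.
Local Open Scope ring_scope.
Local Open Scope complex_scope.

(** The closed disk of center z0 and radius r contains W(T), so for every unit
    direction kappa the hermitian form
      p(x, y) = 2 r <x, y> - conj(kappa) <L x, y> - kappa <x, L y>,  L = T - z0,
    is positive semidefinite; the point z0 + r kappa lies in the closure of W(T)
    exactly when p fails to be coercive, and z0 + r kappa is a value <T x, x>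
    with |x| = 1 as soon as p(x, x) = 0 for some x <> 0.  Half disks and sectors
    both have a circular arc on their boundary that stops at a corner z0 + r w,
    beyond which no point of the circle belongs to the set.  Such a stop is shown to be
    possible only at the point c.  An arc has two ends and only one of them
    can be c: contradiction.

    Why the arc cannot stop elsewhere ([arc_endpoint]): put
    kappa = w (1 + i t)^2 / (1 + t^2), the point of the circle with argument
    2 atan t relative to w.  Multiplied by 1 + t^2, the form p becomes a quadratic
    pencil a0 + t a1 + t^2 a2; the values t > 0 (say) correspond to the arc and
    the values t < 0 to the points beyond the corner.
    Compactness of K and c <> z0 + r w give finitely many vectors e_i such that
    a0(x, x) + sum_i |<x, e_i>|^2 is coercive ([edge_coercive]).
    Solving the corrected pencil for each e_i by the Riesz representation
    theorem ([form_riesz]), the pencil at t is seen to be coercive unless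
    1 - (<X_i(t), e_j>)_ij is singular, and to have an isotropic vector
    if this matrix is singular.
    Its determinant is an analytic function of t near 0 ([analytic0_solve],
    [analytic0_det]); it vanishes along the arc, hence identically near 0
    ([analytic0_identity]).  So for t < 0 as well the pencil has an
    isotropic vector, that is, W(T) contains points of the circle beyond
    the corner ([pencil_kernel_continuation]). *)

(** * Moduli of complex numbers, with real values *)

Section ComplexModulus.
Variable R : realType.
Implicit Types (z w : R[i]) (a t : R).

Definition cabs z : R := complex.Re `|z|.

Lemma cabsE z : `|z| = (cabs z)%:C.
Proof. by rewrite /cabs normc_def. Qed.

Lemma ReD z w : complex.Re (z + w) = complex.Re z + complex.Re w.
Proof. by case: z w => [a b] [c d]. Qed.

Lemma ReN z : complex.Re (- z) = - complex.Re z.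
Proof. by case: z. Qed.

Lemma ReJ z : complex.Re (conjc z) = complex.Re z.
Proof. by case: z. Qed.

Lemma conjcD z w : conjc (z + w) = conjc z + conjc w.
Proof. exact: rmorphD. Qed.

Lemma conjcN z : conjc (- z) = - conjc z.
Proof. exact: rmorphN. Qed.

Lemma conjcM z w : conjc (z * w) = conjc z * conjc w.
Proof. exact: rmorphM. Qed.

Lemma ReM z w :
  complex.Re (z * w) =
  complex.Re z * complex.Re w - complex.Im z * complex.Im w.
Proof. by case: z w => [a b] [c d]. Qed.

Lemma ImM z w :
  complex.Im (z * w) =
  complex.Re z * complex.Im w + complex.Im z * complex.Re w.
Proof. by case: z w => [a b] [c d]. Qed.

Lemma ReMreal a z : complex.Re (a%:C * z) = a * complex.Re z.
Proof. by rewrite ReM /= mul0r subr0. Qed.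

Lemma cabs_sqr z : cabs z ^+ 2 = complex.Re z ^+ 2 + complex.Im z ^+ 2.
Proof. by apply: complexI; rewrite rmorphXn /= -cabsE add_Re2_Im2. Qed.

Lemma cabs_ge0 z : 0 <= cabs z.
Proof. by have := normr_ge0 z; rewrite cabsE ler0c. Qed.

Lemma cabsM z w : cabs (z * w) = cabs z * cabs w.
Proof. by apply: complexI; rewrite rmorphM /= -!cabsE normrM. Qed.

Lemma cabsD z w : cabs (z + w) <= cabs z + cabs w.
Proof. by rewrite -lecR rmorphD /= -!cabsE ler_normD. Qed.

Lemma cabsN z : cabs (- z) = cabs z.
Proof. by rewrite /cabs normrN. Qed.

Lemma cabs0 : cabs 0 = 0.
Proof. by rewrite /cabs normr0. Qed.

Lemma cabs_eq0 z : (cabs z == 0) = (z == 0).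
Proof. by rewrite -(normr_eq0 z) cabsE (inj_eq (@complexI _)). Qed.

Lemma cabs_real a : cabs a%:C = `|a|.
Proof. by rewrite /cabs normc_def /= expr0n addr0 sqrtr_sqr. Qed.

Lemma cabs_imag a : cabs (a *i) = `|a|.
Proof. by rewrite /cabs normc_def /= expr0n add0r sqrtr_sqr. Qed.

Lemma cabs1 : cabs 1 = 1.
Proof. by rewrite /cabs normr1. Qed.

Lemma cabsJ z : cabs (conjc z) = cabs z.
Proof.
by apply/eqP; rewrite -(@eqrXn2 _ 2) ?cabs_ge0 ?cabs_sqr //; case: z => a b /=;
  rewrite sqrrN.
Qed.

Lemma Re_le_cabs z : `|complex.Re z| <= cabs z.
Proof.
rewrite -(@ler_pXn2r _ 2) ?nnegrE ?cabs_ge0 //.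
by rewrite real_normK ?num_real // cabs_sqr lerDl sqr_ge0.
Qed.

Lemma mulcJ z : z * conjc z = (cabs z ^+ 2)%:C.
Proof.
apply/eqP; rewrite cabs_sqr eq_complex; case: z => a b /=.
by apply/andP; split; apply/eqP; ring.
Qed.

Lemma cabs_sum (I : Type) (s : seq I) (P : pred I) (F : I -> R[i]) :
  cabs (\sum_(i <- s | P i) F i) <= \sum_(i <- s | P i) cabs (F i).
Proof.
elim/big_rec2: _ => [|i y x _ xy]; first by rewrite cabs0.
by apply: le_trans (cabsD _ _) _; rewrite lerD2l.
Qed.

End ComplexModulus.

(** * Functions of a real variable that are analytic at 0 *)

Section Analytic.
Variable R : realType.
Implicit Types (f g : R -> R[i]) (t : R).

(** Analyticity is recorded by the successive difference quotients
    F_(n+1)(t) = (F_n(t) - a_n) / t rather than by the convergence of a power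
    series: geometric bounds on them give the identity principle at once, are
    stable under products, and no series has to be summed. *)
Definition taylor_tower (rho C : R) (a : nat -> R[i])
    (F : nat -> R -> R[i]) : Prop :=
  forall n t, `|t| <= rho ->
    F n t = a n + t%:C * F n.+1 t /\ cabs (F n t) <= C ^+ n.+1.

Definition analytic0 f : Prop :=
  exists rho C a F, [/\ 0 < rho, 1 <= C, taylor_tower rho C a F &
    forall t, `|t| <= rho -> f t = F 0%N t].

Lemma taylor_tower_le rho rho' C C' a F : rho' <= rho -> 0 <= C <= C' ->
  taylor_tower rho C a F -> taylor_tower rho' C' a F.
Proof.
move=> le_rho /andP[C0 leC] aF n t tr.
have [eF bF] := aF n t (le_trans tr le_rho).
by split=> //; apply: le_trans bF _; rewrite lerXn2r ?nnegrE // (le_trans C0).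
Qed.

Lemma taylor_tower_coef rho C a F n : 0 <= rho ->
  taylor_tower rho C a F -> cabs (a n) <= C ^+ n.+1.
Proof.
move=> rho0 aF; have [] := aF n 0; first by rewrite normr0.
by rewrite mul0r addr0 => ->.
Qed.

Lemma analytic0_cst (c : R[i]) : analytic0 (fun=> c).
Proof.
exists 1, (cabs c + 1), (fun n => if n is 0%N then c else 0),
  (fun n _ => if n is 0%N then c else 0).
have c1 : 1 <= cabs c + 1 by rewrite lerDr cabs_ge0.
split=> // [[|n] t _]; rewrite ?mulr0 ?addr0; split=> //.
- by rewrite expr1 lerDl.
- by rewrite cabs0 exprn_ge0 // (le_trans _ c1).
Qed.

Lemma analytic0_add f g :
  analytic0 f -> analytic0 g -> analytic0 (fun t => f t + g t).
Proof.
move=> [r [C [a [F [r0 C1 aF fF]]]]] [s [D [b [G [s0 D1 bG gG]]]]].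
exists (Num.min r s), (C + D), (fun n => a n + b n), (fun n t => F n t + G n t).
split.
- by rewrite lt_min r0.
- by rewrite (le_trans C1) // lerDl (le_trans _ D1).
- move=> n t; rewrite le_min => /andP[tr ts].
  have [eF lF] := aF n t tr; have [eG lG] := bG n t ts.
  split; first by rewrite eF eG; ring.
  apply: le_trans (cabsD _ _) _; apply: le_trans (lerD lF lG) _.
  have C0 : 0 <= C by apply: le_trans C1.
  have D0 : 0 <= D by apply: le_trans D1.
  rewrite !(exprSr _ n) mulrDr lerD // ler_wpM2r // lerXn2r ?nnegrE ?addr_ge0 //.
    by rewrite lerDl.
  by rewrite lerDr.
- by move=> t; rewrite le_min => /andP[tr ts]; rewrite fF // gG.
Qed.

(** The tower of a product is h_n = sum_(k < n) a_k g_(n-k) + f_n g_0, the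
    remainder in the Cauchy product of the two expansions. *)
Lemma analytic0_mul f g :
  analytic0 f -> analytic0 g -> analytic0 (fun t => f t * g t).
Proof.
move=> [r [C [a [F [r0 C1 aF fF]]]]] [s [D [b [G [s0 D1 bG gG]]]]].
pose E := C + D; pose q := Num.min r s.
have [C0 D0] : 0 <= C /\ 0 <= D by split; apply: le_trans ler01 _.
have E1 : 1 <= E by rewrite (le_trans C1) // lerDl.
have E0 : 0 <= E by apply: le_trans E1.
have q0 : 0 < q by rewrite lt_min r0.
have aF' : taylor_tower q E a F.
  apply: taylor_tower_le aF; first by rewrite ge_min lexx.
  by rewrite C0 lerDl.
have bG' : taylor_tower q E b G.
  apply: taylor_tower_le bG; first by rewrite ge_min lexx orbT.
  by rewrite D0 lerDr.
exists q, (2 * E ^+ 2), (fun n => \sum_(k < n.+1) a k * b (n - k)%N),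
  (fun n t => \sum_(k < n) a k * G (n - k)%N t + F n t * G 0%N t).
split=> //.
- by have := exprn_ege1 2 E1; lra.
- move=> n t tq; split.
    rewrite !big_ord_recr /= !subnn.
    have [-> _] := aF' n t tq; have [eG _] := bG' 0%N t tq.
    transitivity (\sum_(k < n) a k * b (n - k)%N +
        t%:C * \sum_(k < n) a k * G (n.+1 - k)%N t +
        (a n + t%:C * F n.+1 t) * G 0%N t).
      congr (_ + _); rewrite mulr_sumr -big_split /=; apply: eq_bigr => k _.
      have [-> _] := bG' (n - k)%N t tq.
      by rewrite (subSn (ltnW (ltn_ord k))) mulrDr mulrCA.
    by rewrite subSnn mulrDl {1}eG; ring.
  have lG m : cabs (G m t) <= E ^+ m.+1 by have [] := bG' m t tq.
  have lF m : cabs (F m t) <= E ^+ m.+1 by have [] := aF' m t tq.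
  have la m : cabs (a m) <= E ^+ m.+1.
    by apply: taylor_tower_coef aF'; rewrite ltW.
  have bnd : cabs (\sum_(k < n) a k * G (n - k)%N t + F n t * G 0%N t) <=
      n.+1%:R * E ^+ n.+2.
    rewrite -natr1 mulrDl mul1r; apply: le_trans (cabsD _ _) _; apply: lerD.
      apply: le_trans (cabs_sum _ _ _) _.
      have <- : \sum_(k < n) E ^+ n.+2 = n%:R * E ^+ n.+2.
        by rewrite sumr_const card_ord mulr_natl.
      apply: ler_sum => k _; rewrite cabsM.
      have -> : n.+2 = (k.+1 + (n - k).+1)%N.
        by rewrite addSn addnS subnKC // ltnW.
      by rewrite exprD ler_pM ?cabs_ge0.
    by rewrite cabsM exprSr ler_pM ?cabs_ge0 //; have := lG 0%N; rewrite expr1.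
  apply: le_trans bnd _; rewrite exprMn -exprM ler_pM ?exprn_ge0 //.
    by rewrite -natrX ler_nat ltnW // ltn_expl.
  by rewrite ler_weXn2l // mul2n -addnn addnS addSn ltnS ltnS leq_addl.
- by move=> t; rewrite le_min => /andP[tr ts]; rewrite big_ord0 add0r fF // gG.
Qed.

Lemma analytic0_sum (I : Type) (s : seq I) (P : pred I) (f : I -> R -> R[i]) :
  (forall i, analytic0 (f i)) -> analytic0 (fun t => \sum_(i <- s | P i) f i t).
Proof.
move=> fA; elim: s => [|i s IH].
  by under eq_fun do rewrite big_nil; exact: analytic0_cst.
under eq_fun do rewrite big_cons.
by case: (P i) => //; apply: analytic0_add.
Qed.

Lemma analytic0_prod (I : Type) (s : seq I) (P : pred I) (f : I -> R -> R[i]) :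
  (forall i, analytic0 (f i)) -> analytic0 (fun t => \prod_(i <- s | P i) f i t).
Proof.
move=> fA; elim: s => [|i s IH].
  by under eq_fun do rewrite big_nil; exact: analytic0_cst.
under eq_fun do rewrite big_cons.
by case: (P i) => //; apply: analytic0_mul.
Qed.

Lemma analytic0_det n (A : R -> 'M[R[i]]_n) :
  (forall i j, analytic0 (fun t => A t i j)) -> analytic0 (fun t => \det (A t)).
Proof.
move=> AA; apply: analytic0_sum => s.
by apply: analytic0_mul (analytic0_cst _) _; apply: analytic0_prod.
Qed.

(** Zeros accumulating at 0 kill the Taylor coefficients one after the other:
    f(t) = t^n F_n(t) at those zeros, so F_n vanishes there too and a_n, its
    limit at 0, is null.  Then |f(t)| <= C (C |t|)^n for all n. *)
Lemma analytic0_identity f : analytic0 f ->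
  (forall e : R, 0 < e -> exists t, 0 < `|t| < e /\ f t = 0) ->
  exists2 d : R, 0 < d & forall t, `|t| < d -> f t = 0.
Proof.
move=> [r [C [a [F [r0 C1 aF fF]]]]] f0.
have C0 : 0 < C by apply: lt_le_trans C1.
have coef0 n : (forall e : R, 0 < e ->
    exists t, [/\ 0 < `|t| < e, `|t| <= r & F n t = 0]) -> a n = 0.
  move=> Fn0; apply/eqP; rewrite -cabs_eq0 -[_ == _]negbK; apply/negP => an0.
  have an_gt0 : 0 < cabs (a n) by rewrite lt_def an0 cabs_ge0.
  have Cn0 : 0 < C ^+ n.+2 by rewrite exprn_gt0.
  have [|t [/andP[t0 te] tr Ft]] := Fn0 (cabs (a n) / C ^+ n.+2).
    by rewrite divr_gt0.
  have [eF _] := aF n t tr; have [_ lF] := aF n.+1 t tr.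
  move: eF; rewrite Ft => /esym/eqP; rewrite addr_eq0 => /eqP aE.
  move: te; rewrite ltr_pdivlMr // aE cabsN cabsM cabs_real.
  by rewrite ltNge ler_wpM2l.
have F0 n : forall e : R, 0 < e ->
    exists t, [/\ 0 < `|t| < e, `|t| <= r & F n t = 0].
  elim: n => [|n IH] e e0.
    have [|t [/andP[t0]]] := f0 (Num.min e r); first by rewrite lt_min e0.
    rewrite lt_min => /andP[te tr] ft; exists t.
    by rewrite t0 te (ltW tr) -fF // ltW.
  have an0 : a n = 0 by exact: coef0.
  have [t [/andP[t0 te] tr Ft]] := IH e e0; exists t; split=> //.
    by rewrite t0.
  have [] := aF n t tr; rewrite Ft an0 add0r => /esym/eqP.
  rewrite mulf_eq0 => /orP[|/eqP //].
  by rewrite (inj_eq (@complexI _) t 0) -normr_eq0 gt_eqF.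
have a0 n : a n = 0 by exact: coef0 (F0 n).
(* The bound on |t| makes the ratio C |t| at most 1/2. *)
pose d := Num.min r (2 * C)^-1.
have d0 : 0 < d by rewrite lt_min r0 invr_gt0 mulr_gt0.
exists d => // t; rewrite lt_min => /andP[/ltW tr td].
have fn n : f t = t%:C ^+ n * F n t.
  elim: n => [|n ->]; first by rewrite expr0 mul1r fF.
  by have [-> _] := aF n t tr; rewrite a0 exprSr; ring.
have bnd n : cabs (f t) <= C * (2^-1) ^+ n.
  rewrite (fn n) cabsM -rmorphXn /= cabs_real normrX.
  have [_ lF] := aF n t tr.
  apply: (@le_trans _ _ (`|t| ^+ n * C ^+ n.+1)).
    by rewrite ler_wpM2l // exprn_ge0.
  rewrite exprS mulrCA -exprMn ler_pM2l // lerXn2r ?nnegrE //.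
    by rewrite mulr_ge0 // ltW.
  by apply/ltW; move: td; rewrite invfM -ltr_pdivlMr.
apply/eqP; rewrite -cabs_eq0 eq_le cabs_ge0 andbT.
have cv : (fun n => C * (2^-1 : R) ^+ n) @ \oo --> C * 0.
  apply: cvgM; first exact: cvg_cst.
  by apply: cvg_expr; rewrite ger0_norm ?invr_ge0 // invf_lt1 // ltr1n.
rewrite mulr0 in cv.
apply: (ler_cvg_to (cvg_cst (cabs (f t))) cv).
by near=> n; exact: bnd.
Unshelve. all: by end_near.
Qed.

End Analytic.

Lemma natSinv_small (R : realType) (e : R) : 0 < e ->
  exists N, forall n, (N <= n)%N -> n.+1%:R^-1 < e.
Proof.
move=> e0; have [N _ hN] := near_infty_natSinv_lt (PosNum e0).
by exists N => n Nn; exact: hN.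
Qed.

(** * Hermitian forms and the Riesz representation theorem *)

Section HermitianForms.
Variables (R : realType) (H : completeNormedModType R[i]).
Implicit Types (x y z : H) (k : R[i]) (a : H -> H -> R[i]) (l : H -> R[i]).

Definition rnorm x : R := complex.Re `|x|.

Lemma rnormE x : `|x| = (rnorm x)%:C.
Proof. by rewrite /rnorm RRe_real // normr_real. Qed.

Lemma rnorm_ge0 x : 0 <= rnorm x.
Proof. by have := normr_ge0 x; rewrite rnormE ler0c. Qed.

Lemma rnormD x y : rnorm (x + y) <= rnorm x + rnorm y.
Proof. by rewrite -lecR rmorphD /= -!rnormE ler_normD. Qed.

Lemma rnormZ k x : rnorm (k *: x) = cabs k * rnorm x.
Proof. by apply: complexI; rewrite rmorphM /= -!rnormE -cabsE normrZ. Qed.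

Lemma rnormB x y : rnorm (x - y) = rnorm (y - x).
Proof. by rewrite /rnorm distrC. Qed.

Lemma rnorm0 : rnorm 0 = 0.
Proof. by rewrite /rnorm normr0. Qed.

Lemma rnorm_eq0 x : (rnorm x == 0) = (x == 0).
Proof. by rewrite -(normr_eq0 x) rnormE (inj_eq (@complexI _)). Qed.

Lemma rnorm_sum (I : Type) (s : seq I) (P : pred I) (F : I -> H) :
  rnorm (\sum_(i <- s | P i) F i) <= \sum_(i <- s | P i) rnorm (F i).
Proof.
elim/big_rec2: _ => [|i r x _ xr]; first by rewrite rnorm0.
by apply: le_trans (rnormD _ _) _; rewrite lerD2l.
Qed.

Lemma rnorm_cauchy (u : nat -> H) :
  (forall e : R, 0 < e -> exists N, forall n, (N <= n)%N ->
     rnorm (u n - u N) < e) ->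
  exists x, forall e : R, 0 < e -> exists N, forall n, (N <= n)%N ->
     rnorm (u n - x) < e.
Proof.
move=> uC.
have : cvg (u @ \oo).
  apply: cauchy_cvg; apply: cauchy_exP => e e0.
  have eR : e = (complex.Re e)%:C by rewrite RRe_real // gtr0_real.
  have [|N uN] := uC (complex.Re e); first by rewrite -ltcR -eR.
  exists (u N), N => // n /= Nn.
  by rewrite -ball_normE /= distrC rnormE eR ltcR; exact: uN.
move=> /cvg_ex[x ux]; exists x => e e0.
have e0' : 0 < e%:C :> R[i] by rewrite ltcR.
have /cvgrPdist_lt/(_ _ e0')[N _ uN] := ux.
exists N => n Nn; rewrite rnormB -ltcR -rnormE.
by have := uN n Nn.
Qed.

Record hermitian_form a : Prop := HermitianForm {
  form_linear : forall k x y z, a (k *: x + y) z = k * a x z + a y z;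
  form_conj : forall x y, a y x = conjc (a x y) }.

Definition form_bound a (M : R) : Prop :=
  forall x y, cabs (a x y) <= M * rnorm x * rnorm y.

Definition form_coercive a (eps : R) : Prop :=
  forall x, eps * rnorm x ^+ 2 <= complex.Re (a x x).

Definition antilinear l : Prop :=
  forall k x y, l (k *: x + y) = conjc k * l x + l y.

Section OneForm.
Variables (a : H -> H -> R[i]) (ha : hermitian_form a).

Lemma formZDr k x y z : a z (k *: x + y) = conjc k * a z x + a z y.
Proof.
by rewrite (form_conj ha) (form_linear ha) conjcD conjcM -!(form_conj ha).
Qed.

Lemma formBl x y z : a (x - y) z = a x z - a y z.
Proof. by rewrite -scaleN1r addrC (form_linear ha) mulN1r addrC. Qed.

Lemma form0l z : a 0 z = 0.
Proof. by rewrite -(subrr (0 : H)) formBl subrr. Qed.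

Lemma formZl k x z : a (k *: x) z = k * a x z.
Proof. by rewrite -[k *: x]addr0 (form_linear ha) form0l addr0. Qed.

Lemma formZr k x z : a z (k *: x) = conjc k * a z x.
Proof. by rewrite (form_conj ha) formZl conjcM -(form_conj ha). Qed.

Lemma form_suml (I : Type) (s : seq I) (P : pred I) (F : I -> H) z :
  a (\sum_(i <- s | P i) F i) z = \sum_(i <- s | P i) a (F i) z.
Proof.
elim/big_rec2: _ => [|i r x _ <-]; first exact: form0l.
by rewrite -[F i]scale1r (form_linear ha) scale1r mul1r.
Qed.

(** The quadratic functional whose stationary points solve [a x y = l y]. *)
Definition energy l x : R := complex.Re (a x x) - 2 * complex.Re (l x).

Lemma energyD l k x y : antilinear l ->
  energy l (k *: y + x) =
  energy l x + 2 * complex.Re (conjc k * (a x y - l y)) +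
  cabs k ^+ 2 * complex.Re (a y y).
Proof.
move=> hl; rewrite /energy hl (form_linear ha) !formZDr.
rewrite mulrDr mulrA mulcJ mulrBr !ReD ReN ReMreal.
have -> : complex.Re (k * a y x) = complex.Re (conjc k * a x y).
  by rewrite (form_conj ha x y) -ReJ conjcM conjcK.
ring.
Qed.

(** Perturbing x to x - s z y with z = a x y - l y and s real changes the energy
    by - 2 s |z|^2 + s^2 |z|^2 a(y, y); near-minimality of x bounds this from
    below, and s = 1 / a(y, y) is optimal.  With l = 0 this is the
    Cauchy-Schwarz inequality for semidefinite forms. *)
Lemma energy_stationary l x (eta : R) : antilinear l ->
  (forall y, 0 <= complex.Re (a y y)) ->
  (forall y, energy l x - eta <= energy l y) ->
  forall y, cabs (a x y - l y) ^+ 2 <= eta * complex.Re (a y y).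
Proof.
move=> hl a0 xmin y; set z := a x y - l y; set A := complex.Re (a y y).
have main (s : R) : cabs z ^+ 2 * (2 * s - s ^+ 2 * A) <= eta.
  have := xmin ((- (s%:C * z)) *: y + x).
  rewrite energyD // -/z -/A cabsN cabsM cabs_real exprMn real_normK ?num_real //.
  rewrite conjcN conjcM conjc_real mulNr -mulrA [conjc z * z]mulrC mulcJ.
  by rewrite ReN ReMreal /=; lra.
have A0 : 0 <= A by exact: a0.
have [A1|A1] : A = 0 \/ 0 < A by case: (ltgtP A 0) A0; [lra|right|left].
  rewrite A1 mulr0; have [->//|z0] := eqVneq (cabs z ^+ 2) 0.
  have := main (((cabs z) ^+ 2)^-1 * (`|eta| + 1)).
  rewrite A1 mulr0 subr0 mulrCA mulVKf //; have := ler_norm eta.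
  have := normr_ge0 eta; lra.
have := main A^-1; rewrite -ler_pdivrMr //; apply: le_trans.
by rewrite exprVn expr2 invfM mulfVK ?gt_eqF //; lra.
Qed.

Lemma form_CauchySchwarz x y : (forall z, 0 <= complex.Re (a z z)) ->
  cabs (a x y) ^+ 2 <= complex.Re (a x x) * complex.Re (a y y).
Proof.
move=> a0; have l0 : antilinear (fun=> 0) by move=> *; rewrite mulr0 addr0.
rewrite -[a x y]subr0; apply: (energy_stationary (x := x) l0) => // z.
by rewrite /energy /= !mulr0 !subr0 subrr.
Qed.

Variables (M eps : R).
Hypotheses (bM : form_bound a M) (eps0 : 0 < eps) (ae : form_coercive a eps).

Lemma form_riesz_bound l (L : R) x : 0 <= L ->
  (forall y, cabs (l y) <= L * rnorm y) -> (forall y, a x y = l y) ->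
  rnorm x <= L / eps.
Proof.
move=> L0 lL xl; rewrite ler_pdivlMr //.
have [->|x0] := eqVneq x 0; first by rewrite rnorm0 mul0r.
have x1 : 0 < rnorm x by rewrite lt_def rnorm_eq0 x0 rnorm_ge0.
rewrite -(ler_pM2r x1).
have := ae x; have := lL x; have := Re_le_cabs (a x x); rewrite xl.
have := ler_norm (complex.Re (l x)); lra.
Qed.

(** A minimising sequence of the energy is Cauchy by the parallelogram identity
    and coercivity; its limit solves the equation because near-minimisers do so
    approximately. *)
Lemma form_riesz l (L : R) : antilinear l ->
  (forall y, cabs (l y) <= L * rnorm y) -> exists x, forall y, a x y = l y.
Proof.
move=> hl lL.
have a0 y : 0 <= complex.Re (a y y).
  by apply: le_trans (ae y); rewrite mulr_ge0 ?sqr_ge0 // ltW.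
pose E := range (energy l).
have Elb : lbound E (- (L ^+ 2 / eps)).
  move=> _ [y _ <-]; rewrite /energy.
  have h1 := ae y; have h2 := lL y; have h3 := Re_le_cabs (l y).
  have h4 := ler_norm (complex.Re (l y)).
  have h5 : 0 <= eps * (rnorm y - L / eps) ^+ 2 by rewrite mulr_ge0 ?sqr_ge0 ?ltW.
  have h6 : eps * (rnorm y - L / eps) ^+ 2 =
     eps * rnorm y ^+ 2 - 2 * (L * rnorm y) + L ^+ 2 / eps.
    by field; rewrite gt_eqF.
  lra.
have Einf : has_inf E by split; [exists (energy l 0), 0|exists (- (L ^+ 2 / eps))].
pose d := inf E.
have dE y : d <= energy l y by apply: ge_inf; [case: Einf|exists y].
have /choice[u ud] : forall n : nat, exists x, energy l x < d + n.+1%:R^-1.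
  move=> n; have [|_ [x _ <-] xd] := @inf_adherent _ E n.+1%:R^-1 _ Einf.
    by rewrite invr_gt0.
  by exists x.
have uC n m : eps * rnorm (u n - u m) ^+ 2 <= 2 * (n.+1%:R^-1 + m.+1%:R^-1).
  apply: le_trans (ae _) _; set w := u n - u m.
  have e1 := energyD 1 (u m) w hl; have e2 := energyD (2^-1) (u m) w hl.
  have un : 1 *: w + u m = u n by rewrite scale1r subrK.
  rewrite un conjc1 mul1r in e1.
  have half : conjc (2^-1 : R[i]) = 2^-1 by rewrite conjc_inv conjc_nat.
  have half' : (2^-1 : R[i]) = (2^-1 : R)%:C.
    by rewrite rmorphV /= ?rmorph_nat // unitfE.
  rewrite half half' ReMreal cabs_real ger0_norm ?invr_ge0 // in e2.
  have := dE (2^-1%:C *: w + u m); rewrite e2.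
  have := ud n; have := ud m; rewrite e1 cabs1.
  move: (n.+1%:R^-1) (m.+1%:R^-1) (complex.Re (a w w)) => p q A.
  have -> : (2^-1 : R) ^+ 2 = 1 / 4 by field.
  lra.
have [e e0|x ux] := rnorm_cauchy (u := u).
  have [|N hN] := natSinv_small (e := eps * e ^+ 2 / 4).
    by rewrite divr_gt0 // mulr_gt0 // exprn_gt0.
  exists N => n Nn; rewrite -(@ltr_pXn2r _ 2) ?nnegrE ?rnorm_ge0 ?ltW //.
  rewrite -(ltr_pM2l eps0); apply: le_lt_trans (uC n N) _.
  have := hN n Nn; have := hN N (leqnn N).
  move: (n.+1%:R^-1) (N.+1%:R^-1) => p q; lra.
exists x => y; apply/eqP; rewrite -subr_eq0 -cabs_eq0 eq_le cabs_ge0 andbT.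
apply/ler_addgt0Pl => e e0; rewrite addr0.
set A := complex.Re (a y y); have A0 : 0 <= A by exact: a0.
have [|N1 hN1] := ux (e / (2 * (`|M| * rnorm y + 1))).
  by rewrite divr_gt0 // mulr_gt0 // ltr_wpDl // mulr_ge0 ?rnorm_ge0.
have [|N2 hN2] := natSinv_small (e := (e / 2) ^+ 2 / (A + 1)).
  by rewrite divr_gt0 ?exprn_gt0 ?divr_gt0 // ltr_wpDl.
pose n := maxn N1 N2.
have {hN1} xn : rnorm (u n - x) < e / (2 * (`|M| * rnorm y + 1)).
  by apply: hN1; rewrite leq_maxl.
have {hN2} nA : n.+1%:R^-1 < (e / 2) ^+ 2 / (A + 1).
  by apply: hN2; rewrite leq_maxr.
have -> : a x y - l y = - a (u n - x) y + (a (u n) y - l y).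
  by rewrite formBl; ring.
rewrite [e]splitr; apply: le_trans (cabsD _ _) _; rewrite cabsN; apply: lerD.
  apply: le_trans (bM _ _) _.
  have M0 := normr_ge0 M; have M1 := ler_norm M; have y0 := rnorm_ge0 y.
  move: xn; rewrite ltr_pdivlMr; last first.
    by rewrite mulr_gt0 // ltr_wpDl // mulr_ge0.
  have u0 := rnorm_ge0 (u n - x).
  have : M * (rnorm (u n - x) * rnorm y) <= `|M| * (rnorm (u n - x) * rnorm y).
    by rewrite ler_wpM2r // mulr_ge0.
  lra.
have e2 : 0 <= e / 2 by rewrite divr_ge0 // ltW.
rewrite -(@ler_pXn2r _ 2) ?nnegrE ?cabs_ge0 //.
apply: le_trans (energy_stationary (eta := n.+1%:R^-1) hl a0 _ y) _.
  by move=> z; rewrite lerBlDr; apply: le_trans (ltW (ud n)) _; rewrite lerD2r.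
rewrite -/A; move: nA; rewrite ltr_pdivlMr ?ltr_wpDl //.
have : 0 <= n.+1%:R^-1 :> R by rewrite invr_ge0.
move: (n.+1%:R^-1) => p; lra.
Qed.

End OneForm.
End HermitianForms.

(** * Operations on hermitian forms *)

Section FormAlgebra.
Variables (R : realType) (H : completeNormedModType R[i]).
Implicit Types (a b : H -> H -> R[i]) (l : H -> R[i]).

Lemma hermitian_formD a b : hermitian_form a -> hermitian_form b ->
  hermitian_form (fun x y => a x y + b x y).
Proof.
move=> [la ca] [lb cb]; split=> [k x y z|x y]; first by rewrite la lb; ring.
by rewrite ca cb conjcD.
Qed.

Lemma hermitian_formZ (s : R) a : hermitian_form a ->
  hermitian_form (fun x y => s%:C * a x y).
Proof.
move=> [la ca]; split=> [k x y z|x y]; first by rewrite la; ring.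
by rewrite ca conjcM conjc_real.
Qed.

Lemma hermitian_form_sum n (a : 'I_n -> H -> H -> R[i]) :
  (forall i, hermitian_form (a i)) ->
  hermitian_form (fun x y => \sum_i a i x y).
Proof.
move=> ha; split=> [k x y z|x y].
  rewrite mulr_sumr -big_split /=; apply: eq_bigr => i _.
  by rewrite (form_linear (ha i)).
rewrite rmorph_sum /=; apply: eq_bigr => i _.
by rewrite (form_conj (ha i)).
Qed.

Lemma hermitian_form_rank1 a (e : H) : hermitian_form a ->
  hermitian_form (fun x y => a x e * a e y).
Proof.
move=> [la ca]; split=> [k x y z|x y]; first by rewrite la; ring.
by rewrite conjcM -!ca mulrC.
Qed.

Lemma form_boundD a b (M N : R) : form_bound a M -> form_bound b N ->
  form_bound (fun x y => a x y + b x y) (M + N).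
Proof.
move=> aM bN x y; apply: le_trans (cabsD _ _) _.
by rewrite !mulrDl lerD.
Qed.

Lemma form_boundZ (k : R[i]) a (M : R) : form_bound a M ->
  form_bound (fun x y => k * a x y) (cabs k * M).
Proof. by move=> aM x y; rewrite cabsM -!mulrA ler_wpM2l ?cabs_ge0 // mulrA. Qed.

Lemma form_bound_le a (M N : R) : M <= N -> form_bound a M -> form_bound a N.
Proof.
move=> MN aM x y; apply: le_trans (aM x y) _.
by rewrite -!mulrA ler_wpM2r // mulr_ge0 ?rnorm_ge0.
Qed.

Lemma form_bound_sum n (a : 'I_n -> H -> H -> R[i]) (M : 'I_n -> R) :
  (forall i, form_bound (a i) (M i)) ->
  form_bound (fun x y => \sum_i a i x y) (\sum_i M i).
Proof.
move=> aM x y; apply: le_trans (cabs_sum _ _ _) _.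
by rewrite !mulr_suml; apply: ler_sum => i _; exact: aM.
Qed.

Lemma antilinear_form a z : hermitian_form a -> antilinear (a z).
Proof. by move=> ha k x y; exact: formZDr. Qed.

Lemma antilinearD l l' : antilinear l -> antilinear l' ->
  antilinear (fun y => l y + l' y).
Proof. by move=> hl hl' k x y; rewrite hl hl'; ring. Qed.

Lemma antilinearZ (c : R[i]) l : antilinear l -> antilinear (fun y => c * l y).
Proof. by move=> hl k x y; rewrite hl; ring. Qed.

Lemma unit_direction (x : H) : x != 0 ->
  exists2 u : H, rnorm u = 1 & x = (rnorm x)%:C *: u.
Proof.
move=> x0; have hx : rnorm x != 0 by rewrite rnorm_eq0.
exists ((rnorm x)^-1%:C *: x).
  by rewrite rnormZ cabs_real ger0_norm ?invr_ge0 ?rnorm_ge0 // mulVf.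
by rewrite scalerA -rmorphM /= divff // scale1r.
Qed.

Lemma form_coercive_unit a (eps : R) : hermitian_form a ->
  (forall x, rnorm x = 1 -> eps <= complex.Re (a x x)) -> form_coercive a eps.
Proof.
move=> ha ae x; have [->|/unit_direction[u u1 xu]] := eqVneq x 0.
  by rewrite rnorm0 expr0n mulr0 (form0l ha).
rewrite xu (formZl ha) (formZr ha) conjc_real mulrA -rmorphM /= ReMreal.
rewrite rnormZ u1 mulr1 cabs_real ger0_norm ?rnorm_ge0 // -expr2 mulrC.
by rewrite ler_wpM2l ?sqr_ge0 ?ae.
Qed.

End FormAlgebra.

(** * Semidefinite quadratic pencils with a finite-rank coercive correction *)

Section Pencil.
Variables (R : realType) (H : completeNormedModType R[i]).
Variables (ip : H -> H -> R[i]).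
Hypotheses (ip_herm : hermitian_form ip)
  (ip_norm : forall x, complex.Re (ip x x) = rnorm x ^+ 2).
Variables (a0 a1 a2 : H -> H -> R[i]) (M : R).
Hypotheses (h0 : hermitian_form a0) (h1 : hermitian_form a1)
  (h2 : hermitian_form a2).
Hypotheses (M0 : 0 <= M) (b0 : form_bound a0 M) (b1 : form_bound a1 M)
  (b2 : form_bound a2 M).

Definition pencil (t : R) (x y : H) : R[i] :=
  a0 x y + (t%:C * a1 x y + (t ^+ 2)%:C * a2 x y).

Hypothesis pencil_ge0 : forall t x, 0 <= complex.Re (pencil t x x).

Variables (n : nat) (e : 'I_n -> H) (eps : R).

Definition finite_rank (x y : H) : R[i] := \sum_i ip x (e i) * ip (e i) y.

Hypotheses (eps0 : 0 < eps)
  (coer : form_coercive (fun x y => a0 x y + finite_rank x y) eps).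

Let corrected t x y := pencil t x y + finite_rank x y.

(* For |t| <= rho the terms in t and t^2 cost at most half of the coercivity. *)
Let rho : R := Num.min 1 (eps / (4 * (M + 1))).

Lemma ip_bound : form_bound ip 1.
Proof.
move=> x y; rewrite mul1r.
rewrite -(@ler_pXn2r _ 2) ?nnegrE ?cabs_ge0 ?mulr_ge0 ?rnorm_ge0 //.
rewrite exprMn -!ip_norm; apply: form_CauchySchwarz => // z.
by rewrite ip_norm sqr_ge0.
Qed.

Let finite_rank_herm : hermitian_form finite_rank.
Proof. by apply: hermitian_form_sum => i; exact: hermitian_form_rank1. Qed.

Let pencil_herm t : hermitian_form (pencil t).
Proof.
by apply: hermitian_formD => //; apply: hermitian_formD; exact: hermitian_formZ.
Qed.

Let corrected_herm t : hermitian_form (corrected t).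
Proof. exact: hermitian_formD. Qed.

Let finite_rank_bound : form_bound finite_rank (\sum_i rnorm (e i) ^+ 2).
Proof.
apply: form_bound_sum => i x y; rewrite cabsM.
have := ip_bound x (e i); have := ip_bound (e i) y; rewrite !mul1r => u v.
by apply: le_trans (ler_pM (cabs_ge0 _) (cabs_ge0 _) v u) _; lra.
Qed.

Let rho_gt0 : 0 < rho.
Proof. by rewrite lt_min ltr01 divr_gt0 // mulr_gt0 // ltr_wpDl. Qed.

Let pencil_bound t : `|t| <= rho -> form_bound (pencil t) (3 * M).
Proof.
rewrite le_min => /andP[t1 _].
have -> : 3 * M = M + (1 * M + 1 * M) by ring.
apply: form_boundD => //.
apply: form_boundD; apply: form_bound_le (form_boundZ _ _) => //;
  apply: ler_wpM2r => //.
  by rewrite cabs_real.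
by rewrite cabs_real normrX exprn_ile1.
Qed.

Let corrected_bound t : `|t| <= rho ->
  form_bound (corrected t) (3 * M + \sum_i rnorm (e i) ^+ 2).
Proof. by move=> tr; apply: form_boundD => //; exact: pencil_bound. Qed.

Let corrected_coercive t : `|t| <= rho ->
  form_coercive (corrected t) (eps / 2).
Proof.
rewrite le_min ler_pdivlMr ?mulr_gt0 ?ltr_wpDl // => /andP[t1 tM] x.
rewrite /corrected /pencil; have := coer x; rewrite !ReD !ReMreal.
have r1 := le_trans (Re_le_cabs _) (b1 x x).
have r2 := le_trans (Re_le_cabs _) (b2 x x).
have x0 := rnorm_ge0 x; set h := rnorm x in x0 r1 r2 *.
set A1 := complex.Re (a1 x x) in r1 *; set A2 := complex.Re (a2 x x) in r2 *.
have u1 : - (`|t| * (M * h * h)) <= t * A1.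
  rewrite lerNl -mulNr; apply: le_trans (ler_norm _) _.
  by rewrite normrM normrN ler_wpM2l.
have u2 : - (`|t| * (M * h * h)) <= t ^+ 2 * A2.
  rewrite lerNl -mulNr; apply: le_trans (ler_norm _) _.
  rewrite normrM normrN normrX ler_pM // ?exprn_ge0 //.
  by rewrite expr2 ler_piMr.
have h2' : 0 <= h * h by rewrite mulr_ge0.
have : 0 <= (eps - 4 * (`|t| * M)) * (h * h).
  by rewrite mulr_ge0 //; have := normr_ge0 t; lra.
rewrite expr2; lra.
Qed.

Let solve (t : R) (l : H -> R[i]) : H :=
  xget 0 [set x | forall y, corrected t x y = l y].

Let solveP t l (L : R) : `|t| <= rho -> antilinear l -> 0 <= L ->
  (forall y, cabs (l y) <= L * rnorm y) ->
  (forall y, corrected t (solve t l) y = l y) /\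
  rnorm (solve t l) <= L * 2 / eps.
Proof.
move=> tr hl L0 lL; have e2 : 0 < eps / 2 by rewrite divr_gt0.
have [x xl] := form_riesz (corrected_herm t) (corrected_bound tr) e2
  (corrected_coercive tr) hl lL.
have sl : forall y, corrected t (solve t l) y = l y.
  by apply: (@xgetPex _ 0 [set x | forall y, corrected t x y = l y]); exists x.
split=> //; have := form_riesz_bound e2 (corrected_coercive tr) L0 lL sl.
by rewrite invf_div mulrA.
Qed.

Let corrected_inj t x : `|t| <= rho -> (forall y, corrected t x y = 0) -> x = 0.
Proof.
move=> tr x0; apply/eqP; rewrite -rnorm_eq0 -[_ == 0](@expf_eq0 _ _ 2).
have := corrected_coercive tr x; rewrite x0 /= eq_le sqr_ge0 andbT.
by rewrite pmulr_rle0 // divr_gt0.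
Qed.

Section Taylor.
Variables (u v : H).

(* The Taylor coefficients c_m of the solution satisfy
   b c_(m+1) = - (a1 c_m + a2 c_(m-1)), b being the corrected form at t = 0.
   The m-th state is the right-hand side defining c_m, together with c_(m-1). *)
Let taylor_rhs := fix taylor_rhs (m : nat) : (H -> R[i]) * H :=
  if m is m'.+1 then
    let: (l, w) := taylor_rhs m' in
    let c := solve 0 l in
    (fun y => (-1) * (a1 c y + a2 w y), c)
  else (ip u, 0).

Let coef m : H := solve 0 (taylor_rhs m).1.

(* The m-th difference quotient of the solution solves the corrected equation
   at t itself, with a right-hand side of degree one in t. *)
Let remainder m t : H :=
  solve t (fun y => (taylor_rhs m).1 y + (- t%:C) * a2 (taylor_rhs m).2 y).

(* The constants 8 and 4 make each of the terms M C^m and <u, .> at most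
   eps / 4 C^(m+1), with some room for the factor 2 / eps lost in solving. *)
Let C : R := 1 + 8 * M / eps + 4 * rnorm u / eps.

Let C1 : 1 <= C.
Proof.
by rewrite /C -addrA lerDl addr_ge0 // divr_ge0 ?mulr_ge0 ?rnorm_ge0 // ltW.
Qed.

Let CM : 8 * M <= eps * C.
Proof.
have : 0 <= eps * (1 + 4 * rnorm u / eps).
  by rewrite mulr_ge0 ?addr_ge0 ?divr_ge0 ?mulr_ge0 ?rnorm_ge0 // ltW.
have -> : eps * C = 8 * M + eps * (1 + 4 * rnorm u / eps).
  by rewrite /C; field; rewrite gt_eqF.
by rewrite lerDl.
Qed.

Let Cu : 4 * rnorm u <= eps * C.
Proof.
have : 0 <= eps * (1 + 8 * M / eps).
  by rewrite mulr_ge0 ?addr_ge0 ?divr_ge0 ?mulr_ge0 ?rnorm_ge0 // ltW.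
have -> : eps * C = 4 * rnorm u + eps * (1 + 8 * M / eps).
  by rewrite /C; field; rewrite gt_eqF.
by rewrite lerDl.
Qed.

Let rho_ge0 : `|0 : R| <= rho.
Proof. by rewrite normr0 ltW. Qed.

Let taylor_rhs_bound m :
  [/\ antilinear (taylor_rhs m).1,
      forall y, cabs ((taylor_rhs m).1 y) <= eps / 4 * C ^+ m.+1 * rnorm y
    & rnorm (taylor_rhs m).2 <= C ^+ m].
Proof.
have C0 : 0 <= C by apply: le_trans C1.
elim: m => [|m] /=.
  split; first exact: antilinear_form.
    move=> y; have := ip_bound u y; rewrite expr1 mul1r => /le_trans; apply.
    by rewrite ler_wpM2r ?rnorm_ge0 //; have := Cu; lra.
  by rewrite rnorm0 expr0.
case: (taylor_rhs m) => l w /= [hl lL wC].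
have Cm : 0 <= C ^+ m.+1 by rewrite exprn_ge0.
have L0 : 0 <= eps / 4 * C ^+ m.+1 by rewrite mulr_ge0 ?divr_ge0 // ltW.
have [_ cB] := solveP rho_ge0 hl L0 lL.
have cC : rnorm (solve 0 l) <= C ^+ m.+1.
  apply: le_trans cB _.
  have -> : eps / 4 * C ^+ m.+1 * 2 / eps = C ^+ m.+1 / 2.
    by field; rewrite gt_eqF.
  by lra.
split=> //.
  by apply: antilinearZ; apply: antilinearD; exact: antilinear_form.
move=> y; rewrite mulN1r cabsN; apply: le_trans (cabsD _ _) _.
have y0 := rnorm_ge0 y.
have wC' : rnorm w <= C ^+ m.+1.
  by apply: le_trans wC _; rewrite ler_weXn2l.
have r1 : cabs (a1 (solve 0 l) y) <= M * C ^+ m.+1 * rnorm y.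
  by apply: le_trans (b1 _ _) _; rewrite ler_wpM2r // ler_wpM2l.
have r2 : cabs (a2 w y) <= M * C ^+ m.+1 * rnorm y.
  by apply: le_trans (b2 _ _) _; rewrite ler_wpM2r // ler_wpM2l.
have : 0 <= (eps * C - 8 * M) * (C ^+ m.+1 * rnorm y).
  by rewrite mulr_ge0 ?mulr_ge0 // subr_ge0.
rewrite [C ^+ m.+2]exprS; lra.
Qed.

Let remainderP m t : `|t| <= rho ->
  remainder m t = coef m + t%:C *: remainder m.+1 t /\
  rnorm (remainder m t) <= C ^+ m.+1.
Proof.
move=> tr.
have C0 : 0 <= C by apply: le_trans C1.
have remP k : (forall y, corrected t (remainder k t) y =
    (taylor_rhs k).1 y + (- t%:C) * a2 (taylor_rhs k).2 y) /\
    rnorm (remainder k t) <= C ^+ k.+1.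
  have [hl lL wC] := taylor_rhs_bound k.
  have Ck : 0 <= C ^+ k by rewrite exprn_ge0.
  have L0 : 0 <= eps / 2 * C ^+ k.+1.
    by rewrite mulr_ge0 ?divr_ge0 ?exprn_ge0 // ltW.
  have [||sP sB] := solveP (l := fun y => (taylor_rhs k).1 y +
      (- t%:C) * a2 (taylor_rhs k).2 y) tr _ L0.
  - by apply: antilinearD => //; apply: antilinearZ; exact: antilinear_form.
  - move=> y; apply: le_trans (cabsD _ _) _; have := lL y.
    have y0 := rnorm_ge0 y; rewrite cabsM cabsN cabs_real.
    have : cabs (a2 (taylor_rhs k).2 y) <= M * C ^+ k * rnorm y.
      by apply: le_trans (b2 _ _) _; rewrite ler_wpM2r // ler_wpM2l.
    have : `|t| * cabs (a2 (taylor_rhs k).2 y) <= cabs (a2 (taylor_rhs k).2 y).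
      rewrite ler_piMl ?cabs_ge0 //.
      by move: tr; rewrite le_min => /andP[].
    have : 0 <= (eps * C - 8 * M) * (C ^+ k * rnorm y).
      by rewrite mulr_ge0 ?mulr_ge0 // subr_ge0.
    have : 0 <= M * (C ^+ k * rnorm y) by rewrite !mulr_ge0.
    rewrite [C ^+ k.+1]exprS; lra.
  - split=> //; apply: le_trans sB _.
    have -> // : eps / 2 * C ^+ k.+1 * 2 / eps = C ^+ k.+1.
    by field; rewrite gt_eqF.
have [rm rmB] := remP m; have [rm1 _] := remP m.+1; split=> //.
have coefP y : corrected 0 (coef m) y = (taylor_rhs m).1 y.
  have [hl lL _] := taylor_rhs_bound m.
  have L0 : 0 <= eps / 4 * C ^+ m.+1.
    by rewrite mulr_ge0 ?divr_ge0 ?exprn_ge0 // ltW.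
  by have [->] := solveP rho_ge0 hl L0 lL.
apply/eqP; rewrite -subr_eq0; apply/eqP; apply: (corrected_inj tr) => y.
rewrite (formBl (corrected_herm t)) [coef m + _]addrC.
rewrite (form_linear (corrected_herm t)) rm rm1 -coefP.
have -> : taylor_rhs m.+1 =
    (fun y => (-1) * (a1 (coef m) y + a2 (taylor_rhs m).2 y), coef m).
  by rewrite /coef /=; case: (taylor_rhs m).
rewrite /= /corrected /pencil expr0n /= rmorphXn /=; ring.
Qed.

Lemma analytic0_solve : analytic0 (fun t => ip (solve t (ip u)) v).
Proof.
exists rho, (C * (1 + rnorm v)), (fun m => ip (coef m) v),
  (fun m t => ip (remainder m t) v).
have C0 : 0 <= C by apply: le_trans C1.
split=> //.
- by rewrite -[leLHS]mulr1 ler_pM // lerDl rnorm_ge0.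
- move=> m t tr; have [rE rB] := remainderP m tr; split.
    by rewrite {1}rE addrC (form_linear ip_herm) addrC.
  apply: le_trans (ip_bound _ _) _; rewrite mul1r exprMn.
  rewrite ler_pM ?rnorm_ge0 //.
  apply: (@le_trans _ _ (1 + rnorm v)); first by rewrite lerDr.
  by rewrite ler_eXnr // lerDl rnorm_ge0.
- move=> t tr; congr (ip (solve t _) v); apply: funext => y /=.
  by rewrite (form0l h2) mulr0 addr0.
Qed.

End Taylor.

Let X i t : H := solve t (ip (e i)).

(* Solutions of the homogeneous equation are sums of c_i X_i(t) where c_i is the
   product of the sum with e_i: row vectors c in the kernel of [charmx t]. *)
Let charmx (t : R) : 'M[R[i]]_n := \matrix_(i, j) ((i == j)%:R - ip (X i t) (e j)).

Let charmxE t (c : 'rV[R[i]]_n) j :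
  (c *m charmx t) 0 j = c 0 j - ip (\sum_i c 0 i *: X i t) (e j).
Proof.
rewrite mxE (form_suml ip_herm) (eq_bigr (fun i =>
  c 0 i * (i == j)%:R - ip (c 0 i *: X i t) (e j))); last first.
  by move=> i _; rewrite mxE mulrBr (formZl ip_herm).
rewrite big_split /= sumrN; congr (_ - _).
rewrite (bigD1 j) //= eqxx mulr1 big1 ?addr0 // => i /negbTE->.
by rewrite mulr0.
Qed.

Let XP t i : `|t| <= rho -> forall y, corrected t (X i t) y = ip (e i) y.
Proof.
move=> tr; have [//|_ //] := solveP tr (antilinear_form (e i) ip_herm)
  (rnorm_ge0 (e i)).
by move=> y; have := ip_bound (e i) y; rewrite mul1r.
Qed.

Let corrected_sum t (c : 'rV[R[i]]_n) y : `|t| <= rho ->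
  corrected t (\sum_i c 0 i *: X i t) y = \sum_i c 0 i * ip (e i) y.
Proof.
move=> tr; rewrite (form_suml (corrected_herm t)); apply: eq_bigr => i _.
by rewrite (formZl (corrected_herm t)) XP.
Qed.

Let det0_kernel t : `|t| <= rho -> \det (charmx t) = 0 ->
  exists2 x, x != 0 & complex.Re (pencil t x x) = 0.
Proof.
move=> tr /eqP/det0P[c c0 cK].
pose x := \sum_i c 0 i *: X i t.
have xe j : ip x (e j) = c 0 j.
  have := charmxE t c j; rewrite cK mxE => /esym/eqP.
  by rewrite subr_eq0 => /eqP.
exists x.
  apply: contra_neq c0 => x0; apply/rowP => j.
  by rewrite -xe x0 (form0l ip_herm) mxE.
have : corrected t x x = finite_rank x x.
  rewrite corrected_sum //; apply: eq_bigr => i _; by rewrite xe.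
rewrite /corrected => /eqP; rewrite -subr_eq0 addrK => /eqP -> //.
Qed.

(* If the matrix is invertible, x is controlled by d = x - sum_i <x, e_i> X_i(t),
   and d by the value of the pencil at x, since the corrected form at (d, d) is
   the pencil at (x, d), which Cauchy-Schwarz bounds. *)
Let noncoercive_det0 t : `|t| <= rho ->
  (forall eta, 0 < eta ->
     exists x, complex.Re (pencil t x x) < eta * rnorm x ^+ 2) ->
  \det (charmx t) = 0.
Proof.
move=> tr nc; apply/eqP; rewrite -[_ == 0]negbK -unitfE; apply/negP => dU.
pose V := invmx (charmx t).
pose B := 1 + \sum_i (\sum_j rnorm (e j) * cabs (V j i)) * rnorm (X i t).
have B0 : 0 < B.
  rewrite ltr_wpDr // sumr_ge0 // => i _; rewrite mulr_ge0 ?rnorm_ge0 //.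
  by rewrite sumr_ge0 // => j _; rewrite mulr_ge0 ?rnorm_ge0 ?cabs_ge0.
pose P := 3 * M.
have P0 : 0 <= P by rewrite mulr_ge0.
have BP : 0 < B ^+ 2 * P + 1 by rewrite ltr_wpDl // mulr_ge0 ?sqr_ge0.
have [|x xq] := nc ((eps / 2) ^+ 2 / (B ^+ 2 * P + 1)).
  by rewrite divr_gt0 // exprn_gt0 // divr_gt0.
pose c : 'rV[R[i]]_n := \row_j ip x (e j).
pose d := x - \sum_i c 0 i *: X i t.
have dA : c *m charmx t = \row_j ip d (e j).
  by apply/rowP => j; rewrite charmxE !mxE (formBl ip_herm).
have cE i : cabs (c 0 i) <= rnorm d * \sum_j rnorm (e j) * cabs (V j i).
  have -> : c = (\row_j ip d (e j)) *m V by rewrite -dA mulmxK // unitmxE.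
  rewrite mxE mulr_sumr; apply: le_trans (cabs_sum _ _ _) _.
  apply: ler_sum => j _; rewrite cabsM mxE mulrA ler_wpM2r ?cabs_ge0 //.
  by have := ip_bound d (e j); rewrite mul1r.
have xd : rnorm x <= B * rnorm d.
  have {1}-> : x = d + \sum_i c 0 i *: X i t by rewrite subrK.
  apply: le_trans (rnormD _ _) _; rewrite mulrDl mul1r lerD2l.
  apply: le_trans (rnorm_sum _ _ _) _; rewrite mulr_suml.
  apply: ler_sum => i _; rewrite rnormZ mulrAC ler_wpM2r ?rnorm_ge0 //.
  by rewrite mulrC.
have dd : corrected t d d = pencil t x d.
  rewrite {1}/d (formBl (corrected_herm t)) corrected_sum // /corrected.
  rewrite /finite_rank -[RHS]addr0 -addrA; congr (_ + _).
  apply/eqP; rewrite subr_eq0; apply/eqP; apply: eq_bigr => i _.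
  by rewrite mxE.
have d0 := rnorm_ge0 d; have x0 := rnorm_ge0 x.
have cs : (eps / 2 * rnorm d ^+ 2) ^+ 2 <=
    complex.Re (pencil t x x) * (P * rnorm d ^+ 2).
  apply: (@le_trans _ _ (cabs (pencil t x d) ^+ 2)).
    have e2 : 0 <= eps / 2 by rewrite divr_ge0 // ltW.
    rewrite lerXn2r ?nnegrE ?cabs_ge0 ?(mulr_ge0 e2) ?sqr_ge0 //.
    apply: le_trans (corrected_coercive tr d) _; rewrite dd.
    by apply: le_trans (ler_norm _) _; exact: Re_le_cabs.
  apply: le_trans (form_CauchySchwarz (pencil_herm t) _ _ (pencil_ge0 t)) _.
  rewrite ler_wpM2l //; apply: le_trans (ler_norm _) _.
  apply: le_trans (Re_le_cabs _) _; rewrite expr2 mulrA.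
  exact: pencil_bound.
set q := complex.Re _ in xq cs.
have q0 : 0 <= q by exact: pencil_ge0.
have dq : (eps / 2) ^+ 2 * rnorm d ^+ 2 <= q * P.
  have [->|dn0] := eqVneq (rnorm d) 0.
    by rewrite expr0n mulr0 mulr_ge0.
  have d2 : 0 < rnorm d ^+ 2 by rewrite exprn_gt0 // lt_def dn0.
  by rewrite -(ler_pM2r d2); move: cs; rewrite exprMn; lra.
have x2 : rnorm x ^+ 2 <= B ^+ 2 * rnorm d ^+ 2.
  by rewrite -exprMn lerXn2r ?nnegrE ?mulr_ge0 // ltW.
move: xq; rewrite mulrAC ltr_pdivlMr // => xq.
have e2 : 0 < (eps / 2) ^+ 2 by rewrite exprn_gt0 // divr_gt0.
have s1 : (eps / 2) ^+ 2 * rnorm x ^+ 2 <=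
    B ^+ 2 * ((eps / 2) ^+ 2 * rnorm d ^+ 2).
  by rewrite [leRHS]mulrCA ler_pM2l.
have s2 : B ^+ 2 * ((eps / 2) ^+ 2 * rnorm d ^+ 2) <= B ^+ 2 * (q * P).
  by rewrite ler_wpM2l ?sqr_ge0.
lra.
Qed.

(** Unique continuation: degeneracy of the pencil is the vanishing of an
    analytic determinant, so if it occurs for parameters accumulating
    at 0 it occurs for all parameters near 0, on both sides. *)
Lemma pencil_kernel_continuation :
  (forall d : R, 0 < d -> exists t, 0 < `|t| < d /\
     forall eta, 0 < eta ->
       exists x, complex.Re (pencil t x x) < eta * rnorm x ^+ 2) ->
  exists2 d : R, 0 < d & forall t, `|t| < d ->
    exists2 x, x != 0 & complex.Re (pencil t x x) = 0.
Proof.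
move=> acc.
have detA : analytic0 (fun t => \det (charmx t)).
  apply: analytic0_det => i j.
  under eq_fun do rewrite mxE -mulN1r.
  by apply: analytic0_add (analytic0_cst _) _;
    apply: analytic0_mul (analytic0_cst _) _; exact: analytic0_solve.
have [|d d0 det0] := analytic0_identity detA.
  move=> s s0; have [|t [/andP[t0]]] := acc (Num.min s rho).
    by rewrite lt_min s0.
  rewrite lt_min => /andP[ts tr] nc; exists t; rewrite t0 ts; split=> //.
  exact: noncoercive_det0 (ltW tr) nc.
exists (Num.min d rho) => [|t]; first by rewrite lt_min d0.
by rewrite lt_min => /andP[td tr]; apply: det0_kernel (ltW tr) (det0 t td).
Qed.

End Pencil.

(** * Compact operators *)

Section CompactOperators.
Variables (R : realType) (H : completeNormedModType R[i]).

Lemma compact_operator_net (K : {linear H -> H}) (e : R) :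
  compact_operator K -> 0 < e -> exists n (y : 'I_n -> H),
    forall x, rnorm x <= 1 -> exists i, rnorm (K x - y i) < e.
Proof.
move=> Kc e0; have e0' : 0 < e%:C :> R[i] by rewrite ltcR.
pose A := [set x : H | `|x| <= 1].
have Ab : bounded_set A.
  exists 1; split; first exact: real1.
  by move=> m m1 x /= x1; apply: le_trans x1 (ltW m1).
have := Kc A Ab; rewrite precompactE compact_cover => cov.
have [||D _ Dcov] := cov H setT (fun y => ball y e%:C).
- by move=> y _; exact: ball_open.
- by move=> y _; exists y => //; exact: ballxx.
pose s : seq H := finmap.enum_fset D.
exists (size s), (fun i => nth 0 s i) => x x1.
have [|y yD yx] := Dcov (K x).
  by apply: subset_closure; exists x => //; rewrite /A /= rnormE (lecR _ 1).
have iD : (index y s < size s)%N by rewrite index_mem.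
exists (Ordinal iD); rewrite /= nth_index //.
by move: yx; rewrite -ball_normE /= distrC rnormE ltcR.
Qed.

Lemma compact_operator_bounded (K : {linear H -> H}) : compact_operator K ->
  exists2 M : R, 0 <= M & forall x, rnorm (K x) <= M * rnorm x.
Proof.
move=> Kc; have [n [y yP]] := compact_operator_net Kc ltr01.
have S0 : 0 <= \sum_i rnorm (y i) by rewrite sumr_ge0 // => i _; exact: rnorm_ge0.
exists (1 + \sum_i rnorm (y i)); first by rewrite addr_ge0.
move=> x; have [->|x0] := eqVneq x 0; first by rewrite linear0 rnorm0 mulr0.
have hx : 0 < rnorm x by rewrite lt_def rnorm_eq0 x0 rnorm_ge0.
have [|i yi] := yP ((rnorm x)^-1%:C *: x).
  by rewrite rnormZ cabs_real ger0_norm ?invr_ge0 ?rnorm_ge0 // mulVf ?gt_eqF.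
rewrite -ler_pdivrMr // mulrC.
have -> : (rnorm x)^-1 * rnorm (K x) = rnorm (K ((rnorm x)^-1%:C *: x)).
  by rewrite linearZ rnormZ cabs_real ger0_norm ?invr_ge0 ?rnorm_ge0.
rewrite -[K _](subrK (y i)); apply: le_trans (rnormD _ _) _.
apply: lerD; first exact: ltW.
by rewrite (bigD1 i) //= lerDl sumr_ge0 // => j _; exact: rnorm_ge0.
Qed.

End CompactOperators.

(** * Geometry of the circle *)

Section PlaneGeometry.
Variable R : realType.
Implicit Types (z w : R[i]) (t r : R).

Lemma closure_cabsP (A : set R[i]^o) z :
  closure A z <-> forall e : R, 0 < e -> exists2 w, A w & cabs (w - z) < e.
Proof.
split=> [Az e e0|Az B].
  have e0' : 0 < e%:C :> R[i] by rewrite ltcR.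
  have [w [Aw]] := Az (ball (z : R[i]^o) e%:C) (nbhsx_ballx _ _ e0').
  by rewrite -ball_normE /= distrC cabsE ltcR; exists w.
move=> /nbhs_ballP[e /= e0 eB].
have eR : e = (complex.Re e)%:C by rewrite RRe_real // gtr0_real.
have [|w Aw wz] := Az (complex.Re e); first by rewrite -ltcR -eR.
exists w; split=> //; apply: eB.
by rewrite -ball_normE /= distrC cabsE eR ltcR.
Qed.

(** Rational parametrisation of the unit circle: [circle_point t] has argument
    [2 * atan t]. *)
Definition circle_point t : R[i] :=
  ((1 - t ^+ 2) / (1 + t ^+ 2)) +i* (2 * t / (1 + t ^+ 2)).

(** Up to the factor 1 + t^2, the component of z along [circle_point t]. *)
Definition circle_dir t z : R :=
  (1 - t ^+ 2) * complex.Re z + 2 * t * complex.Im z.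

Lemma onesqr_gt0 t : 0 < 1 + t ^+ 2.
Proof. by rewrite ltr_wpDr // sqr_ge0. Qed.

Lemma cabs_circle_point t : cabs (circle_point t) = 1.
Proof.
have t0 := onesqr_gt0 t.
apply/eqP; rewrite -(@eqrXn2 _ 2) ?cabs_ge0 // cabs_sqr /= expr1n; apply/eqP.
by field; rewrite gt_eqF.
Qed.

Lemma circle_dir_point t r : circle_dir t (r%:C * circle_point t) = (1 + t ^+ 2) * r.
Proof.
have t0 := onesqr_gt0 t.
rewrite /circle_dir ReM ImM /= !mul0r subr0 addr0.
by field; rewrite gt_eqF.
Qed.

Lemma circle_dir_sqr t z :
  circle_dir t z ^+ 2 =
  (1 + t ^+ 2) ^+ 2 * cabs z ^+ 2 -
  ((1 - t ^+ 2) * complex.Im z - 2 * t * complex.Re z) ^+ 2.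
Proof. by rewrite /circle_dir cabs_sqr; ring. Qed.

Lemma circle_dir_le t z : circle_dir t z <= (1 + t ^+ 2) * cabs z.
Proof.
apply: le_trans (ler_norm _) _; have t0 := onesqr_gt0 t.
rewrite -(@ler_pXn2r _ 2) ?nnegrE ?mulr_ge0 ?cabs_ge0 // ?(ltW t0) //.
rewrite real_normK ?num_real // circle_dir_sqr exprMn gerBl.
exact: sqr_ge0.
Qed.

Lemma circle_dir_max t r z : cabs z <= r -> circle_dir t z = (1 + t ^+ 2) * r ->
  (1 + t ^+ 2) * complex.Im z = 2 * t * r.
Proof.
move=> zr zE; have t0 := onesqr_gt0 t.
have r0 : 0 <= r by apply: le_trans zr; exact: cabs_ge0.
have z2 : cabs z ^+ 2 <= r ^+ 2 by rewrite lerXn2r ?nnegrE ?cabs_ge0.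
have : ((1 - t ^+ 2) * complex.Im z - 2 * t * complex.Re z) ^+ 2 <= 0.
  have := circle_dir_sqr t z; rewrite zE exprMn.
  have : (1 + t ^+ 2) ^+ 2 * cabs z ^+ 2 <= (1 + t ^+ 2) ^+ 2 * r ^+ 2.
    by rewrite ler_wpM2l ?sqr_ge0.
  lra.
rewrite le_eqVlt ltNge sqr_ge0 orbF sqrf_eq0 subr_eq0 => /eqP E.
apply: (mulfI (lt0r_neq0 t0)).
move: zE; rewrite /circle_dir => zE.
have -> : (1 + t ^+ 2) * ((1 + t ^+ 2) * complex.Im z) =
  (1 - t ^+ 2) * ((1 - t ^+ 2) * complex.Im z) + 4 * t ^+ 2 * complex.Im z by ring.
rewrite E.
have -> : (1 - t ^+ 2) * (2 * t * complex.Re z) + 4 * t ^+ 2 * complex.Im z =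
  2 * t * ((1 - t ^+ 2) * complex.Re z + 2 * t * complex.Im z) by ring.
by rewrite zE; ring.
Qed.

End PlaneGeometry.

(** * Arcs in the boundary of the numerical range *)

Section ArcEndpoint.
Variables (R : realType) (H : completeNormedModType R[i])
  (dot : {dot H for (@Num.conj R[i])}) (hdot : norm_from_dot dot)
  (c : R[i]) (K : {linear H -> H}) (hK : compact_operator K).
Variables (z0 : R[i]) (r : R) (w : R[i]) (r0 : 0 < r) (w1 : cabs w = 1).

Let ip (x y : H) : R[i] := dot x y.
Let T (x : H) : H := c *: x + K x.
Let L (x : H) : H := (c - z0) *: x + K x.
Let W := numerical_range dot T.

Let ip_herm : hermitian_form ip.
Proof.
split=> [k x y z|x y]; first by rewrite /ip linearPl.
by rewrite /ip hermC /= expr0 mul1r.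
Qed.

Let ip_diag x : ip x x = (rnorm x ^+ 2)%:C.
Proof. by rewrite /ip -hdot rnormE rmorphXn. Qed.

Let ip_norm x : complex.Re (ip x x) = rnorm x ^+ 2.
Proof. by rewrite ip_diag. Qed.

Let ip1 x y : cabs (ip x y) <= rnorm x * rnorm y.
Proof. by have := ip_bound ip_herm ip_norm x y; rewrite mul1r. Qed.

Let L_linear k x y : L (k *: x + y) = k *: L x + L y.
Proof.
rewrite /L linearP !scalerDr !scalerA [(c - z0) * k]mulrC.
by rewrite addrACA.
Qed.

Let ipL x : ip (L x) x = ip (T x) x - z0 * ip x x.
Proof.
rewrite /L /T !(form_linear ip_herm); ring.
Qed.

Definition cross_form (k : R[i]) (x y : H) : R[i] :=
  k * ip (L x) y + conjc k * ip x (L y).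

Let cross_form_herm k : hermitian_form (cross_form k).
Proof.
split=> [m x y z|x y].
  by rewrite /cross_form L_linear !(form_linear ip_herm); ring.
rewrite /cross_form conjcD !conjcM conjcK addrC.
by rewrite -!(form_conj ip_herm).
Qed.

Let Re_cross_form k x :
  complex.Re (cross_form k x x) = 2 * complex.Re (k * ip (L x) x).
Proof.
rewrite /cross_form ReD [ip x (L x)](form_conj ip_herm) -conjcM ReJ; ring.
Qed.

(* The coefficients in t of the form 2 r <x, y> - conj(kappa) <L x, y>
   - kappa <x, L y> multiplied by 1 + t^2, where kappa = w (1 + i t)^2 / (1 + t^2). *)
Let edge_form0 (x y : H) := (2 * r)%:C * ip x y + cross_form (- conjc w) x y.
Let edge_form1 := cross_form (2 *i * conjc w).
Let edge_form2 (x y : H) := (2 * r)%:C * ip x y + cross_form (conjc w) x y.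

Let Re_edge k x : complex.Re ((2 * r)%:C * ip x x + cross_form k x x) =
  2 * r * rnorm x ^+ 2 + 2 * complex.Re (k * ip (L x) x).
Proof. by rewrite ReD ReMreal Re_cross_form ip_norm. Qed.

Let Re_pencil t x :
  complex.Re (pencil edge_form0 edge_form1 edge_form2 t x x) =
  2 * ((1 + t ^+ 2) * (r * rnorm x ^+ 2) -
       circle_dir t (conjc w * ip (L x) x)).
Proof.
have Re3 (u0 u1 u2 : R[i]) : complex.Re (u0 + (t%:C * u1 + (t ^+ 2)%:C * u2)) =
    complex.Re u0 + (t * complex.Re u1 + t ^+ 2 * complex.Re u2).
  by rewrite !ReD !ReMreal.
have ReI u v : complex.Re (2 *i * u * v : R[i]) = - (2 * complex.Im (u * v)).
  by rewrite -mulrA ReM /=; ring.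
rewrite /pencil Re3 !Re_edge Re_cross_form ReI mulNr ReN /circle_dir; ring.
Qed.

Hypothesis disk : forall z, W z -> cabs (z - z0) <= r.

Let W_unit x : rnorm x = 1 -> W (ip (T x) x).
Proof. by move=> x1; exists x => //=; rewrite rnormE x1. Qed.

Let WE z : W z -> exists2 x, rnorm x = 1 & z = ip (T x) x.
Proof. by move=> [x /= x1 <-]; exists x => //; rewrite /rnorm x1. Qed.

Let W_homogeneous (x : H) : x != 0 ->
  exists2 z, W z & ip (L x) x = (rnorm x ^+ 2)%:C * (z - z0).
Proof.
move=> /unit_direction[u u1 xu]; exists (ip (T u) u); first exact: W_unit.
have Lu : ip (L u) u = ip (T u) u - z0 by rewrite ipL ip_diag u1 expr1n mulr1.
have Lx : L x = (rnorm x)%:C *: L u.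
  have L0 : L 0 = 0 by rewrite /L !linear0 addr0.
  by rewrite {1}xu -[_ *: u]addr0 L_linear L0 !addr0.
rewrite -Lu Lx {2}xu (formZl ip_herm) (formZr ip_herm) conjc_real mulrA.
by rewrite -rmorphM /= -expr2.
Qed.

Let edge_pencil_ge0 t x :
  0 <= complex.Re (pencil edge_form0 edge_form1 edge_form2 t x x).
Proof.
rewrite Re_pencil mulr_ge0 // subr_ge0.
apply: le_trans (circle_dir_le _ _) _; rewrite ler_wpM2l ?(ltW (onesqr_gt0 t)) //.
have [->|/W_homogeneous[z Wz ->]] := eqVneq x 0.
  by rewrite rnorm0 expr0n mulr0 (form_conj ip_herm) (form0l ip_herm) conjc0 mulr0
    cabs0.
rewrite !cabsM cabsJ w1 mul1r cabs_real ger0_norm ?sqr_ge0 // mulrC.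
by rewrite ler_wpM2r ?sqr_ge0 ?disk.
Qed.

(* If Re (conj(w) (c - z0)) <> r, then <K x, x> = 0 would give the form at x the
   nonzero value 2 (r - Re (conj(w) (c - z0))).  If it is r, then c is not
   in the disk, hence not in the closure of W, and <K x, x> = <T x, x> - c is
   bounded away from 0. *)
Let edge_or_compact : c != z0 + r%:C * w ->
  exists2 delta : R, 0 < delta & forall x, rnorm x = 1 ->
    delta <= complex.Re (edge_form0 x x) \/ delta <= cabs (ip (K x) x).
Proof.
move=> cw; pose beta := r - complex.Re (conjc w * (c - z0)).
have ipLK x : rnorm x = 1 -> ip (L x) x = (c - z0) + ip (K x) x.
  by move=> x1; rewrite (form_linear ip_herm) ip_diag x1 expr1n mulr1.
have edge_ge0 x : 0 <= complex.Re (edge_form0 x x).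
  have := edge_pencil_ge0 0 x; rewrite /pencil expr0n /= !mul0r.
  by rewrite !addr0.
have [b0|b0] := eqVneq beta 0.
  have ncl : ~ closure W c.
    move=> /closure_cabsP cW.
    have cr : cabs (c - z0) <= r.
      apply/ler_addgt0Pl => e e0; have [z Wz zc] := cW e e0.
      have -> : c - z0 = - (z - c) + (z - z0) by ring.
      by apply: le_trans (cabsD _ _) _; rewrite cabsN lerD ?disk // ltW.
    have p : complex.Re (conjc w * (c - z0)) = r by move: b0; rewrite /beta; lra.
    have : cabs (conjc w * (c - z0)) ^+ 2 <= r ^+ 2.
      by rewrite lerXn2r ?nnegrE ?cabs_ge0 ?(ltW r0) // cabsM cabsJ w1 mul1r.
    rewrite cabs_sqr p gerDl le_eqVlt ltNge sqr_ge0 orbF sqrf_eq0 => /eqP q.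
    have pq : conjc w * (c - z0) = r%:C.
      by apply/eqP; rewrite eq_complex p q !eqxx.
    move/eqP: cw; apply.
    transitivity (z0 + w * conjc w * (c - z0)).
      by rewrite mulcJ w1 expr1n mul1r addrC subrK.
    by rewrite -pq; ring.
  have [delta d0 dW] : exists2 delta : R, 0 < delta &
      forall z, W z -> delta <= cabs (z - c).
    apply: contrapT => nd; apply: ncl; apply/closure_cabsP => e e0.
    apply: contrapT => ne; apply: nd; exists e => // z Wz.
    by rewrite leNgt; apply/negP => ze; apply: ne; exists z.
  exists delta => // x x1; right.
  have -> : ip (K x) x = ip (T x) x - c; last exact/dW/W_unit.
  by rewrite (form_linear ip_herm) ip_diag x1 expr1n mulr1 addrC addKr.
exists (`|beta| / 2) => [|x x1]; first by rewrite divr_gt0 // normr_gt0.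
have [|Kx] := leP (`|beta| / 2) (cabs (ip (K x) x)); first by right.
left; have := edge_ge0 x.
have -> : complex.Re (edge_form0 x x) =
    2 * (beta - complex.Re (conjc w * ip (K x) x)).
  rewrite Re_edge x1 ipLK // /beta.
  by rewrite mulNr mulrDr ReN ReD; ring.
have := Re_le_cabs (conjc w * ip (K x) x).
rewrite cabsM cabsJ w1 mul1r => /le_lt_trans/(_ Kx).
by case: (ltrP 0 beta) => b; [rewrite (gtr0_norm b)|rewrite (ler0_norm b)];
  rewrite ltr_norml; lra.
Qed.

(* The e_i are the centers of a finite net of the image of the unit ball: where
   <K x, x> is not small, neither is the product of x with a center near K x. *)
Let edge_coercive : c != z0 + r%:C * w ->
  exists n (e : 'I_n -> H) (eps : R), 0 < eps /\
    form_coercive (fun x y => edge_form0 x y + finite_rank ip e x y) eps.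
Proof.
move=> /edge_or_compact[delta d0 dP].
have d2 : 0 < delta / 2 by rewrite divr_gt0.
have [n [y yP]] := compact_operator_net hK d2.
exists n, y, (Num.min delta ((delta / 2) ^+ 2)); split.
  by rewrite lt_min d0 exprn_gt0.
have hF : hermitian_form (finite_rank ip y).
  by apply: hermitian_form_sum => i; exact: hermitian_form_rank1.
have h0 : hermitian_form edge_form0.
  by apply: hermitian_formD => //; exact: hermitian_formZ.
apply: form_coercive_unit; first exact: hermitian_formD.
move=> x x1; rewrite ReD ge_min.
have FE : complex.Re (finite_rank ip y x x) = \sum_i cabs (ip x (y i)) ^+ 2.
  rewrite /finite_rank (eq_bigr (fun i => (cabs (ip x (y i)) ^+ 2)%:C)).
    by rewrite -rmorph_sum.
  by move=> i _; rewrite (form_conj ip_herm x (y i)) mulcJ.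
have F0 i : 0 <= cabs (ip x (y i)) ^+ 2 by exact: sqr_ge0.
have S0 : 0 <= \sum_i cabs (ip x (y i)) ^+ 2 by rewrite sumr_ge0.
have := edge_pencil_ge0 0 x; rewrite /pencil expr0n /= !mul0r !addr0 => e0.
case: (dP x x1) => [le|lK]; apply/orP; [left|right]; rewrite FE.
  lra.
have [|i yi] := yP x; first by rewrite x1.
have : delta / 2 <= cabs (ip x (y i)).
  rewrite (form_conj ip_herm (y i)) cabsJ.
  have := cabsD (ip (K x - y i) x) (ip (y i) x).
  rewrite (formBl ip_herm) subrK.
  have := ip1 (K x - y i) x; rewrite (formBl ip_herm) x1 mulr1; lra.
move=> dy; have : (delta / 2) ^+ 2 <= cabs (ip x (y i)) ^+ 2.
  by rewrite lerXn2r ?nnegrE ?cabs_ge0 ?(ltW d2).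
have : cabs (ip x (y i)) ^+ 2 <= \sum_i cabs (ip x (y i)) ^+ 2.
  by rewrite [leRHS](bigD1 i) //= lerDl sumr_ge0.
lra.
Qed.

Let edge_noncoercive t : closure W (z0 + r%:C * w * circle_point t) ->
  forall eta, 0 < eta -> exists x,
    complex.Re (pencil edge_form0 edge_form1 edge_form2 t x x) <
    eta * rnorm x ^+ 2.
Proof.
move=> /closure_cabsP tW eta eta0; have t0 := onesqr_gt0 t.
have [|z /WE[x x1 zE] zt] := tW (eta / (2 * (1 + t ^+ 2))).
  by rewrite divr_gt0 // mulr_gt0.
exists x; rewrite Re_pencil x1 expr1n !mulr1.
rewrite ipL ip_diag x1 expr1n mulr1 -zE.
set p := z - (z0 + r%:C * w * circle_point t) in zt.
have -> : conjc w * (z - z0) = - (- (conjc w * p)) + r%:C * circle_point t.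
  rewrite opprK /p; have : w * conjc w = 1 by rewrite mulcJ w1 expr1n.
  move=> ww; transitivity (conjc w * (z - z0) +
     (1 - w * conjc w) * (r%:C * circle_point t)).
    by rewrite ww subrr mul0r addr0.
  ring.
have dirD u v : circle_dir t (- u + v) = circle_dir t v - circle_dir t u.
  by case: u v => [a b] [a' b']; rewrite /circle_dir /=; ring.
rewrite dirD circle_dir_point.
have := circle_dir_le t (- (conjc w * p)); rewrite cabsN cabsM cabsJ w1 mul1r.
move: zt; rewrite ltr_pdivlMr ?mulr_gt0 //.
lra.
Qed.

(** Here sigma = 1 or -1 tells on which side of the radius through w the
    numerical range lies.  If c were not the end point, unique continuation of
    the pencil would put a point of the circle on the wrong side. *)
Lemma arc_endpoint (sigma : R) : `|sigma| = 1 ->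
  (forall z, W z -> 0 <= sigma * complex.Im (conjc w * (z - z0))) ->
  (forall d : R, 0 < d -> exists t, 0 < `|t| < d /\
     closure W (z0 + r%:C * w * circle_point t)) ->
  c = z0 + r%:C * w.
Proof.
move=> s1 side acc; apply/eqP; rewrite -[_ == _]negbK; apply/negP => cw.
have [n [e [eps [eps0 coer]]]] := edge_coercive cw.
have [MK MK0 KM] := compact_operator_bounded hK.
pose ML := cabs (c - z0) + MK.
have ML0 : 0 <= ML by rewrite addr_ge0 ?cabs_ge0.
have LM x : rnorm (L x) <= ML * rnorm x.
  apply: le_trans (rnormD _ _) _; rewrite rnormZ mulrDl lerD2l; exact: KM.
have cross_bound k : form_bound (cross_form k) (cabs k * (2 * ML)).
  move=> x y; apply: le_trans (cabsD _ _) _; rewrite !cabsM cabsJ.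
  have u1 := ip1 (L x) y; have u2 := ip1 x (L y).
  have v1 : rnorm (L x) * rnorm y <= ML * rnorm x * rnorm y.
    by rewrite ler_wpM2r ?rnorm_ge0.
  have v2 : rnorm x * rnorm (L y) <= rnorm x * (ML * rnorm y).
    by rewrite ler_wpM2l ?rnorm_ge0.
  rewrite -mulrDr -!mulrA ler_wpM2l ?cabs_ge0 //; lra.
have edge_bound k : cabs k = 1 ->
    form_bound (fun x y => (2 * r)%:C * ip x y + cross_form k x y) (2 * r + 4 * ML).
  move=> k1; apply: (@form_bound_le _ _ _ (cabs (2 * r)%:C * 1 + cabs k * (2 * ML))).
    by rewrite cabs_real gtr0_norm ?mulr_gt0 // k1; lra.
  by apply: form_boundD => //; apply: form_boundZ => x y; rewrite mul1r.
have b0 : form_bound edge_form0 (2 * r + 4 * ML).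
  by apply: edge_bound; rewrite cabsN cabsJ.
have b2 : form_bound edge_form2 (2 * r + 4 * ML).
  by apply: edge_bound; rewrite cabsJ.
have b1 : form_bound edge_form1 (2 * r + 4 * ML).
  apply: form_bound_le (cross_bound _); rewrite cabsM cabsJ w1 mulr1.
  rewrite cabs_imag ger0_norm //.
  by rewrite mulrA -natrM lerDr mulr_ge0 // ltW.
have B0 : 0 <= 2 * r + 4 * ML by rewrite addr_ge0 // mulr_ge0 // ltW.
have he k : hermitian_form (fun x y => (2 * r)%:C * ip x y + cross_form k x y).
  by apply: hermitian_formD => //; exact: hermitian_formZ.
have [|d d0 dP] := pencil_kernel_continuation ip_herm ip_norm (he _)
  (cross_form_herm _) (he _) B0 b0 b1 b2 edge_pencil_ge0 eps0 coer.
  move=> d d0; have [t [td tW]] := acc d d0; exists t; split=> //.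
  exact: edge_noncoercive.
(* A parameter beyond the corner. *)
have [|x x0] := dP (- sigma * (d / 2)).
  by rewrite normrM normrN s1 mul1r gtr0_norm ?divr_gt0 //; lra.
set t := - sigma * (d / 2).
have [z Wz Lz] := W_homogeneous x0.
have x2 : 0 < rnorm x ^+ 2 by rewrite exprn_gt0 // lt_def rnorm_eq0 x0 rnorm_ge0.
rewrite Re_pencil Lz => /eqP; rewrite mulf_eq0 pnatr_eq0 /= subr_eq0 => /eqP.
have -> : circle_dir t (conjc w * ((rnorm x ^+ 2)%:C * (z - z0))) =
    rnorm x ^+ 2 * circle_dir t (conjc w * (z - z0)).
  rewrite mulrCA /circle_dir ReMreal [complex.Im (_%:C * _)]ImM /= mul0r addr0.
  by ring.
rewrite mulrCA mulrC [RHS]mulrC -mulrA => E.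
have zdir : circle_dir t (conjc w * (z - z0)) = (1 + t ^+ 2) * r.
  by apply: (mulIf (lt0r_neq0 x2)); rewrite -E; ring.
have := circle_dir_max _ zdir; rewrite cabsM cabsJ w1 mul1r => /(_ (disk Wz)).
move=> Im_z; have := side z Wz.
rewrite -(pmulr_rge0 _ (onesqr_gt0 t)) mulrCA Im_z /t.
have s2 : sigma ^+ 2 = 1 by rewrite -[sigma ^+ 2]real_normK ?num_real // s1 expr1n.
have -> : sigma * (2 * (- sigma * (d / 2)) * r) = - (sigma ^+ 2 * (d * r)).
  by field.
by rewrite s2 mul1r oppr_ge0 leNgt mulr_gt0.
Qed.

End ArcEndpoint.

(** * Half disks and sectors *)

Section SectorsAndHalfDisks.
Variable R : realType.
Implicit Types (z u : R[i]) (r t alpha theta : R).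

Definition cis alpha : R[i] := cos alpha +i* sin alpha.

Lemma cisD alpha theta : cis (alpha + theta) = cis alpha * cis theta.
Proof.
by apply/eqP; rewrite eq_complex /= cosD sinD [sin _ * _ + _]addrC !eqxx.
Qed.

Lemma cabs_cis alpha : cabs (cis alpha) = 1.
Proof.
apply/eqP; rewrite -(@eqrXn2 _ 2) ?cabs_ge0 // cabs_sqr /= cos2Dsin2.
by rewrite expr1n.
Qed.

Lemma conjc_cis alpha : conjc (cis alpha) = cis (- alpha).
Proof. by rewrite /cis cosN sinN. Qed.

Lemma circle_point_atan t : circle_point t = cis (2 * atan t).
Proof.
have t0 := onesqr_gt0 t.
have c2 : cos (atan t) ^+ 2 = (1 + t ^+ 2)^-1.
  by rewrite cos_atan exprVn sqr_sqrtr // ltW.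
have c0 : cos (atan t) != 0.
  by rewrite -sqrf_eq0 c2 invr_eq0 gt_eqF.
have s : sin (atan t) = t * cos (atan t).
  by have := mulfVK c0 (sin (atan t)); rewrite -/(tan _) atanK.
rewrite /circle_point /cis [2 * atan t]mulr_natl mulr2n cosD sinD s; congr (_ +i* _).
- have -> : cos (atan t) * cos (atan t) - t * cos (atan t) * (t * cos (atan t))
    = (1 - t ^+ 2) * cos (atan t) ^+ 2 by ring.
  by rewrite c2.
- have -> : t * cos (atan t) * cos (atan t) + cos (atan t) * (t * cos (atan t))
    = 2 * t * cos (atan t) ^+ 2 by ring.
  by rewrite c2.
Qed.

Lemma closed_half_disk_norm z0 r u z :
  closed_half_disk z0 r u z -> cabs (z - z0) <= r.
Proof. by move=> [/=]; rewrite cabsE lecR. Qed.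

Lemma closed_half_disk_side z0 r u z : closed_half_disk z0 r u z ->
  0 <= complex.Re (conjc u * (z - z0)).
Proof. by move=> [/= _]; rewrite mulrC. Qed.

Lemma closed_half_disk_arc z0 r u (s : R) t : 0 <= r -> cabs u = 1 ->
  `|s| = 1 -> s * t <= 0 ->
  closed_half_disk z0 r u (z0 + r%:C * (s *i * u) * circle_point t).
Proof.
move=> r0 u1 s1 st; have t0 := onesqr_gt0 t.
split; rewrite addrC addKr.
  rewrite cabsE lecR !cabsM u1 cabs_imag s1 cabs_circle_point cabs_real.
  by rewrite ger0_norm // !mulr1.
have -> : r%:C * (s *i * u) * circle_point t * Num.conj u =
    r%:C * (s *i * circle_point t) * (u * conjc u) by rewrite -/(conjc u); ring.
rewrite mulcJ u1 expr1n mulr1 ReMreal mulr_ge0 // ReM /= mul0r sub0r.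
rewrite mulrA mulrCA -mulNr divr_ge0 ?(ltW t0) //; lra.
Qed.

Lemma closed_sector_norm z0 r alpha theta z :
  closed_sector z0 r alpha theta z -> cabs (z - z0) <= r.
Proof.
move=> [rho [t [/andP[rho0 rhor] _ ->]]].
rewrite addrC addKr cabsM cabs_real -/(cis t) cabs_cis mulr1.
by rewrite ger0_norm.
Qed.

Lemma closed_sector_first_side z0 r alpha theta z : theta <= pi ->
  closed_sector z0 r alpha theta z ->
  0 <= complex.Im (conjc (cis alpha) * (z - z0)).
Proof.
move=> tp [rho [t [/andP[rho0 _] /andP[t1 t2] ->]]].
rewrite [_ - z0]addrC addKr -/(cis t) mulrCA conjc_cis -cisD ImM /= mul0r addr0.
rewrite mulr_ge0 // sin_ge0_pi //; lra.
Qed.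

Lemma closed_sector_last_side z0 r alpha theta z : theta <= pi ->
  closed_sector z0 r alpha theta z ->
  complex.Im (conjc (cis (alpha + theta)) * (z - z0)) <= 0.
Proof.
move=> tp [rho [t [/andP[rho0 _] /andP[t1 t2] ->]]].
rewrite [_ - z0]addrC addKr -/(cis t) mulrCA conjc_cis -cisD ImM /= mul0r addr0.
rewrite -oppr_ge0 -mulrN -sinN mulr_ge0 // sin_ge0_pi //; lra.
Qed.

Lemma closed_sector_arc z0 r alpha theta t : 0 <= r -> alpha <= t <= alpha + theta ->
  closed_sector z0 r alpha theta (z0 + r%:C * cis t).
Proof. by move=> r0 at_; exists r, t; rewrite lexx r0. Qed.

Lemma atan_small theta : 0 < theta < pi -> forall d : R, 0 < d ->
  exists t, 0 < t < d /\ 0 <= 2 * atan t <= theta.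
Proof.
move=> /andP[th0 thpi] d d0.
pose s := tan (theta / 2).
have thI : theta / 2 \in `]- (pi / 2), pi / 2[%R.
  by rewrite in_itv /=; apply/andP; split; have := pi_gt0 R; lra.
have s0 : 0 < s.
  rewrite -tan0 ltr_tan ?divr_gt0 // in_itv /=.
  by apply/andP; split; have := pi_gt0 R; lra.
pose t := Num.min (d / 2) s.
have t0 : 0 < t by rewrite lt_min s0 divr_gt0.
have td : t <= d / 2 by rewrite ge_min lexx.
have ts : t <= s by rewrite ge_min lexx orbT.
exists t; split; first by rewrite t0 /=; lra.
have := le_atan ts; rewrite /s tanK // => a1.
have := le_atan (ltW t0); rewrite atan0 => a0.
apply/andP; split; lra.
Qed.

End SectorsAndHalfDisks.

Theorem mainTheorem4 (R : realType) (H : completeNormedModType R[i])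
    (dot : {dot H for (@Num.conj R[i])}) (hdot : norm_from_dot dot)
    (c : R[i]) (K : {linear H -> H}) (hK : compact_operator K) :
  let T : H -> H := fun x => c *: x + K x in
  (forall (z0 : R[i]) (r : R) (u : R[i]), 0 < r -> `|u| = 1 ->
     closure (numerical_range dot T) <> closed_half_disk z0 r u) /\
  (forall (z0 : R[i]) (r alpha theta : R), 0 < r -> 0 < theta < pi / 2 ->
     closure (numerical_range dot T) <> closed_sector z0 r alpha theta).
Proof.
move=> T; set W := numerical_range dot T.
have WS (S : set R[i]^o) : closure W = S -> forall z, W z -> S z.
  by move=> <- z; exact: subset_closure.
split=> [z0 r u r0 u1|z0 r alpha theta r0 /andP[th0 thpi]] WE.
  have {}u1 : cabs u = 1 by rewrite /cabs u1.
  (* The corners are z0 + r i u and z0 - r i u. *)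
  have end_point (s : R) : `|s| = 1 -> c = z0 + r%:C * (s *i * u).
    move=> s1; have s2 : s ^+ 2 = 1.
      by rewrite -[s ^+ 2]real_normK ?num_real // s1 expr1n.
    apply: (arc_endpoint hdot hK r0 _ _ (sigma := - s)).
    - by rewrite cabsM cabs_imag s1 u1 mulr1.
    - by move=> z /(WS _ WE)/closed_half_disk_norm.
    - by rewrite normrN.
    - move=> z /(WS _ WE)/closed_half_disk_side.
      have -> : conjc (s *i * u) * (z - z0) = (- s) *i * (conjc u * (z - z0)).
        by rewrite conjcM mulrA.
      rewrite ImM /= mul0r add0r mulrA -expr2 sqrrN s2 mul1r; exact.
    - move=> d d0; exists (- s * (d / 2)); split.
        rewrite normrM normrN s1 mul1r gtr0_norm ?divr_gt0 //; lra.
      rewrite -/T -/W WE; apply: closed_half_disk_arc => //; first exact: ltW.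
      rewrite mulrA mulrN -expr2 s2; lra.
  have := end_point 1 (normr1 _).
  have -> := end_point (-1) (normrN1 _).
  move=> /addrI/(mulfI _) E; have {E} : (-1) *i * u = 1 *i * u :> R[i].
    by apply: E; rewrite (inj_eq (@complexI _) r 0) gt_eqF.
  have u0 : u != 0 by rewrite -cabs_eq0 u1 oner_eq0.
  move=> /(mulIf u0)[]; lra.
have pi0 := pi_gt0 R; have thpi' : theta <= pi by lra.
have acc := @atan_small R theta _.
have first : c = z0 + r%:C * cis alpha.
  apply: (arc_endpoint hdot hK r0 (cabs_cis _) _ (sigma := 1)).
  - by move=> z /(WS _ WE)/closed_sector_norm.
  - by rewrite normr1.
  - by move=> z /(WS _ WE)/(closed_sector_first_side thpi'); rewrite mul1r.
  - move=> d /acc[|t [/andP[t0 td] /andP[a0 a1]]]; first by rewrite th0; lra.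
    exists t; split; first by rewrite gtr0_norm // t0.
    rewrite -/T -/W WE circle_point_atan -mulrA -cisD.
    by apply: closed_sector_arc; [exact: ltW|lra].
have last : c = z0 + r%:C * cis (alpha + theta).
  apply: (arc_endpoint hdot hK r0 (cabs_cis _) _ (sigma := -1)).
  - by move=> z /(WS _ WE)/closed_sector_norm.
  - by rewrite normrN1.
  - move=> z /(WS _ WE)/(closed_sector_last_side thpi').
    by rewrite mulN1r oppr_ge0.
  - move=> d /acc[|t [/andP[t0 td] /andP[a0 a1]]]; first by rewrite th0; lra.
    exists (- t); split; first by rewrite normrN gtr0_norm // t0.
    rewrite -/T -/W WE circle_point_atan -mulrA -cisD atanN.
    by apply: closed_sector_arc; [exact: ltW|lra].
have : cis alpha = cis (alpha + theta).
  move: last; rewrite first => /addrI/(mulfI _); apply.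
  by rewrite (inj_eq (@complexI _) r 0) gt_eqF.
rewrite cisD -[LHS]mulr1 => /mulfI E.
have nz : cis alpha != 0 by rewrite -cabs_eq0 cabs_cis oner_eq0.
have s0 : sin theta = 0 := esym (congr1 (@complex.Im R) (E nz)).
have : 0 < sin theta by rewrite sin_gt0_pi // th0; lra.
by rewrite s0 ltxx.
Qed.
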